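(* Let $\lambda\in(0,1)$ and $-1/n\le p\le\infty$. For Borel functions $f,g:\mathbb{R}^n\to[0,\infty)$ and $*$ the rearrangement to a convex set $K\subseteq\mathbb{R}^n$, $$\int_{\mathbb{R}^n} f\,\square_{\mathcal{M}_p^\lambda}\,g(x)\,dx\;\ge\;\int_{\mathbb{R}^n} f^*\,\square_{\mathcal{M}_p^\lambda}\,g^*(x)\,dx\;\ge\;\mathcal{M}^\lambda_{p/(np+1)}\left(\int_{\mathbb{R}^n} f(x)\,dx,\int_{\mathbb{R}^n} g(x)\,dx\right).$$
   Context: For $u,v\in[0,\infty)$: if $uv=0$ then $\mathcal{M}_p^\lambda(u,v)=0$ for every $p\in[-\infty,\infty]$; if $uv\ne0$ then $\mathcal{M}_p^\lambda(u,v)=((1-\lambda)u^p+\lambda v^p)^{1/p}$ for $p\in\mathbb{R}\setminus\{0\}$, $\mathcal{M}_0^\lambda(u,v)=u^{1-\lambda}v^\lambda$, $\mathcal{M}_\infty^\lambda(u,v)=\max\{u,v\}$, $\mathcal{M}_{-\infty}^\lambda(u,v)=\min\{u,v\}$. Each is extended to $[0,\infty]^2$ by $\mathcal{M}(x)=\sup\{\mathcal{M}(y): y\in[0,\infty)^2,\ y_1<x_1,\ y_2<x_2\}$ (empty supremum $=0$). The exponent $p/(np+1)$ is read as $-\infty$ for $p=-1/n$ and as $1/n$ for $p=\infty$. Define $$f\,\square_{\mathcal{M}_p^\lambda}\,g(z)=\sup_{(1-\lambda)x+\lambda y=z}\mathcal{M}_p^\lambda(f(x),g(y)).$$ $|\cdot|_n$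 is Lebesgue measure on $\mathbb{R}^n$. Rearrangement to a convex set: $K$ is a non-empty open convex set with $0<|K|_n<\infty$ and $0\in\overline K$; for Borel $A\subseteq\mathbb{R}^n$, $A^*=(|A|_n/|K|_n)^{1/n}K$, with $A^*=\varnothing$ if $|A|_n=0$ and $A^*=\bigcup_{r>0}rK$ if $|A|_n=\infty$; for Borel $f\ge0$, $f^*(x)=\int_0^\infty\mathbf{1}_{\{f>s\}^*}(x)\,ds$ (possibly $+\infty$). The sup-convolutions are universally measurable and integrals are with respect to completed Lebesgue measure. *)

(* Defs.v *)
From HB Require Import structures.
From mathcomp Require Import all_boot all_order all_algebra.
From mathcomp Require Import all_classical all_reals all_analysis.

Set Implicit Arguments.
Unset Strict Implicit.
Unset Printing Implicit Defensive.

Import Order.TTheory GRing.Theory Num.Theory.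
Import numFieldNormedType.Exports.

Local Open Scope classical_set_scope.
Local Open Scope ring_scope.

(* The completed Lebesgue measure on R^(n.+1): the Caratheodory restriction of
   the outer measure obtained by covering with countably many half-open boxes.
   The dimension is n.+1 because in dimension 0 no family of boxes indexed by
   nat would give volume 0 to the empty set. *)
Section lebesgue_rV.
Context (R : realType) (n : nat).
Local Notation V := 'rV[R]_n.+1.

Definition box (c : V * V) : set V :=
  [set x | forall i, c.1 ord0 i < x ord0 i <= c.2 ord0 i].

Definition box_volume (c : V * V) : R :=
  \prod_(i < n.+1) Num.max 0 (c.2 ord0 i - c.1 ord0 i).

Definition lebesgue_outer (A : set V) : \bar R :=
  ereal_inf [set (\sum_(k <oo) (box_volume (c k))%:E)%E |
             c in [set c : nat -> V * V | A `<=` \bigcup_k box (c k)]].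

Lemma box_volume_ge0 c : 0 <= box_volume c.
Proof. by apply: prodr_ge0 => i _; rewrite le_max lexx. Qed.

Let vol (c : V * V) : \bar R := (box_volume c)%:E.

Let vol_ge0 c : (0 <= vol c)%E.
Proof. by rewrite lee_fin box_volume_ge0. Qed.

Lemma lebesgue_outer_ge0 A : (0 <= lebesgue_outer A)%E.
Proof.
by apply: le_ereal_inf_tmp => _ [c _ <-]; apply: nneseries_ge0 => k _ _;
  exact: vol_ge0.
Qed.

Lemma lebesgue_outer0 : lebesgue_outer set0 = 0%E.
Proof.
apply/eqP; rewrite eq_le lebesgue_outer_ge0 andbT.
apply: ereal_inf_lbound; exists (fun=> (0, 0)) => //=.
rewrite eseries0// => k _ _; congr (_%:E).
by rewrite /box_volume big_ord_recl/= subrr maxxx mul0r.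
Qed.

Lemma le_lebesgue_outer : {homo lebesgue_outer : A B / A `<=` B >-> (A <= B)%E}.
Proof.
move=> A B AB; apply/ereal_inf_le_tmp => _ [c Bc <-].
by exists c => //=; exact: subset_trans Bc.
Qed.

Lemma lebesgue_outer_sigma_subadditive : sigma_subadditive lebesgue_outer.
Proof.
move=> A; have [[i ioo]|] := pselect (exists i, lebesgue_outer (A i) = +oo%E).
  rewrite (eseries_pinfty _ _ ioo) ?leey// => m _.
  by rewrite -ltNye (lt_le_trans _ (lebesgue_outer_ge0 _)).
rewrite -forallNE => Aoo.
apply/lee_addgt0Pr => _/posnumP[e].
apply: le_trans (epsilon_trick _ _ _); last 2 first.
- by move=> m; exact: lebesgue_outer_ge0.
- by [].
pose P m (B : nat -> V * V) := A m `<=` \bigcup_k box (B k) /\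
  (\sum_(k <oo) vol (B k) <= lebesgue_outer (A m)
                             + (e%:num / (2 ^ m.+1)%:R)%:E)%E.
have [G PG] : {G : nat -> nat -> V * V & forall m, P m (G m)}.
  apply: (@choice _ _ P) => m; rewrite /P.
  have en1 : 0 < e%:num / (2 ^ m.+1)%:R by [].
  have /(lb_ereal_inf_adherent en1) : lebesgue_outer (A m) \is a fin_num.
    by rewrite ge0_fin_numE ?lebesgue_outer_ge0// ltey; apply/eqP/Aoo.
  by move=> [_ [B AB <-] /ltW leB]; exists B.
have volG_ge0 x : (0 <= (vol \o uncurry G) x)%E by exact: vol_ge0.
apply: (@le_trans _ _ (\esum_(i in setT) (vol \o uncurry G) i)).
  apply: ereal_inf_lbound => /=.
  have /card_esym/ppcard_eqP[f] := card_nat2.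
  exists (uncurry G \o f) => /=.
    move=> t [i _] /(PG i).1 [j _ ?]; exists (f^-1%FUN (i, j)) => //=.
    by rewrite invK ?inE.
  rewrite -(esum_pred_image (vol \o uncurry G) _ xpredT) ?[fun=> _]set_true//.
  by rewrite image_eq.
rewrite (_ : esum _ _ = \sum_(i <oo) \sum_(j <oo) vol (G i j))%E; last first.
  pose J : nat -> set (nat * nat) := fun i => [set (i, j) | j in setT].
  rewrite (_ : setT = \bigcup_k J k); last first.
    by rewrite predeqE => -[a b]; split => // _; exists a => //; exists b.
  rewrite esum_bigcupT /=; last 2 first.
    - apply/trivIsetP => i j _ _ ij.
      rewrite predeqE => -[a b] /=; split => //= -[] [_] _ [<-{a} _].
      by move=> [m' _] [] /esym/eqP; rewrite (negbTE ij).
    - by move=> /= [a b]; exact: vol_ge0.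
  rewrite -(image_id [set: nat]) -fun_true esum_pred_image//; last first.
    by move=> a _; exact: esum_ge0.
  apply: eq_eseriesr => /= j _.
  rewrite -(esum_pred_image (vol \o uncurry G) (pair j) predT)//=; last first.
    by move=> ? ? _ _; exact: (@can_inj _ _ _ snd).
  by congr esum; rewrite predeqE => -[a b]; split; move=> [i _ <-]; exists i.
apply: lee_nneseries => [m _ _|m _]; last exact: (PG m).2.
by apply: nneseries_ge0 => k _ _; exact: vol_ge0.
Qed.

HB.instance Definition _ := isOuterMeasure.Build R V lebesgue_outer
  lebesgue_outer0 lebesgue_outer_ge0 le_lebesgue_outer
  lebesgue_outer_sigma_subadditive.

Definition lebesgue_rV : set (caratheodory_type lebesgue_outer) -> \bar R :=
  lebesgue_outer.

HB.instance Definition _ := isMeasure.Build _ _ _ lebesgue_rV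
  lebesgue_outer0
  lebesgue_outer_ge0
  (@caratheodory_measure_sigma_additive R V lebesgue_outer).

Definition borel_rV : Type := g_sigma_algebraType (@open V).

HB.instance Definition _ := Measurable.on borel_rV.

End lebesgue_rV.
Arguments lebesgue_rV {R n}.

Section means.
Context (R : realType).

Definition pmean (lam : R) (p : \bar R) (u v : R) : R :=
  if u * v == 0 then 0 else
  match p with
  | r%:E => if r == 0 then u `^ (1 - lam) * v `^ lam
            else ((1 - lam) * u `^ r + lam * v `^ r) `^ r^-1
  | +oo%E => Num.max u v
  | -oo%E => Num.min u v
  end.

(* Extension to [0, +oo]^2 as the supremum over strictly smaller finite points;
   the element 0 accounts for the empty supremum and is otherwise harmless. *)
Definition epmean (lam : R) (p : \bar R) (x y : \bar R) : \bar R :=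
  match x, y with
  | u%:E, v%:E => (pmean lam p u v)%:E
  | _, _ => ereal_sup ([set 0%E] `|`
      [set (pmean lam p w.1 w.2)%:E | w in [set w : R * R |
        [/\ 0 <= w.1, 0 <= w.2, (w.1%:E < x)%E & (w.2%:E < y)%E]]])
  end.

(* p / (d p + 1); the value at p = -oo is irrelevant. *)
Definition mean_exponent (d : nat) (p : \bar R) : \bar R :=
  match p with
  | r%:E => if r == - d%:R^-1 then -oo%E else (r / (d%:R * r + 1))%:E
  | +oo%E => (d%:R^-1)%:E
  | -oo%E => -oo%E
  end.

End means.

Section rearrangement.
Context (R : realType) (n : nat).
Local Notation V := 'rV[R]_n.+1.

Definition sup_convolution (lam : R) (M : \bar R -> \bar R -> \bar R)
    (f g : V -> \bar R) (z : V) : \bar R :=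
  ereal_sup [set M (f w.1) (g w.2) |
             w in [set w : V * V | (1 - lam) *: w.1 + lam *: w.2 = z]].

Definition rearrangement_body (K : set V) : Prop :=
  [/\ K !=set0, open K, convex_set K, (0 < lebesgue_rV K < +oo)%E
    & closure K 0].

Definition dilate (r : R) (K : set V) : set V := [set r *: x | x in K].

Definition set_rearrangement (K A : set V) : set V :=
  if lebesgue_rV A == 0%E then set0
  else if lebesgue_rV A == +oo%E then
    \bigcup_(r in [set r : R | 0 < r]) dilate r K
  else dilate ((fine (lebesgue_rV A) / fine (lebesgue_rV K))
                 `^ (n.+1%:R^-1)) K.

Definition fun_rearrangement (K : set V) (f : V -> R) (x : V) : \bar R :=
  (\int[lebesgue_measure]_(s in `[0%R, +oo[)
     (\1_(set_rearrangement K [set y | (s < f y)%R]) x)%:E)%E.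

End rearrangement.

(* Main.v *)
(** The superlevel sets of the sup-convolution of [f] and [g] contain the
    Minkowski combinations [(1 - lam) {f > u} + lam {g > v}] with
    [M_p(u, v) > s], while those of the sup-convolution of the rearrangements
    are unions of the combinations of [{f > u}*] and [{g > v}*]. The latter are
    dilates of [K], hence nested, so the Brunn-Minkowski inequality (proved
    following Hadwiger and Ohmann, by cutting disjoint boxes along hyperplanes)
    compares the measures of the superlevel sets, and the first inequality
    follows by summing over levels. Approximating by compact sets from inside
    avoids any measurability question on the left-hand side.

    For the second inequality, replace [f*] and [g*] by step functions of the
    volume of the dilates of [K] and subdivide both so that matching steps carry
    the same fraction of the integrals. The volume of combined dilates is a
    superadditive 1/d-mean of the volumes, so Hoelder's inequality for means
    bounds each contribution below by that fraction of the claimed lower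
    bound. *)

(* The exponent q = p/(dp + 1) is Hoelder's: volumes combine with exponent 1/d, values with exponent
   p, and 1/q = d + 1/p. The range p >= -1/d is the one in which q keeps the sign of p. Two
   obstacles shape the arguments. The means drop to 0 as soon as one argument is 0, and rearranged
   functions may be infinite; both are met by reducing each level s < M_p(F(x), G(y)) to finite u, v
   > 0 strictly below F(x), G(y) with s < M_p(u, v). The left-hand sup-convolution is not shown to
   be measurable; since the integral of a nonnegative function is a supremum over simple functions
   below it, measurable subsets of the superlevel sets suffice for lower bounds. In the second
   inequality, equal fractions t of the integrals S and T turn the bound into M_q(tS, tT) = t M_q(S,
   T), which is additive in t; superadditivity lets these contributions be stacked on one growing
   family of dilates. *)
Require Import Defs.
From mathcomp Require Import all_boot all_order all_algebra.
From mathcomp Require Import all_classical all_reals all_analysis.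
From mathcomp Require Import measurable_realfun.
From mathcomp Require Import ring lra.

Set Implicit Arguments.
Unset Strict Implicit.
Unset Printing Implicit Defensive.

Import Order.TTheory GRing.Theory Num.Theory.
Import numFieldNormedType.Exports.

Local Open Scope classical_set_scope.
Local Open Scope ring_scope.

(** * Power means *)

Section power_means.
Context (R : realType).
Implicit Types (a b c lam r s u v x y : R) (p : \bar R).

(** Weighted AM-GM: with [m] the weighted mean of the logarithms, the tangent bound 1 + t <= exp t
    is applied to [ln x - m] and [ln y - m], whose weighted sum vanishes. *)
Lemma young_powR a b x y : 0 < x -> 0 < y -> 0 <= a -> 0 <= b -> a + b = 1 ->
  x `^ a * y `^ b <= a * x + b * y.
Proof.
move=> x0 y0 a0 b0 ab1.
rewrite /powR !gt_eqF// -expRD.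
set m := a * ln x + b * ln y.
have xE : x = expR m * expR (ln x - m) by rewrite -expRD addrC subrK lnK.
have yE : y = expR m * expR (ln y - m) by rewrite -expRD addrC subrK lnK.
have hx := @expR_ge1Dx R (ln x - m).
have hy := @expR_ge1Dx R (ln y - m).
have e0 := expR_gt0 m.
rewrite [in leRHS]xE [in leRHS]yE.
rewrite mulrCA [b * _]mulrCA -mulrDr ler_peMr ?(ltW e0)//.
have h1 : a * (1 + (ln x - m)) <= a * expR (ln x - m) by rewrite ler_wpM2l.
have h2 : b * (1 + (ln y - m)) <= b * expR (ln y - m) by rewrite ler_wpM2l.
apply: (le_trans _ (lerD h1 h2)).
have -> : a * (1 + (ln x - m)) + b * (1 + (ln y - m)) =
  (a + b) + m - (a + b) * m by rewrite /m; ring.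
by rewrite ab1 mul1r addrK.
Qed.

(** Reversed Young inequality: [young_powR] is applied to x^a y^b and x with weights 1/b and -a/b,
    for which the weighted geometric mean is exactly y. *)
Lemma young_powR_neg a b x y : 0 < x -> 0 < y -> a <= 0 -> a + b = 1 ->
  a * x + b * y <= x `^ a * y `^ b.
Proof.
move=> x0 y0 a0 ab1.
have b1 : 1 <= b by lra.
have b0 : 0 < b by lra.
have ib : 0 <= b^-1 by rewrite invr_ge0 ltW.
have ab : 0 <= - a / b by rewrite divr_ge0 ?oppr_ge0// ltW.
have e1 : b^-1 + - a / b = 1.
  by rewrite -{1}(mul1r b^-1) -mulrDl -ab1 addrAC subrr add0r divff// gt_eqF.
have := young_powR (mulr_gt0 (powR_gt0 a x0) (powR_gt0 b y0)) x0 ib ab e1.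
rewrite powRM ?powR_ge0// -!powRrM divff ?gt_eqF// powRr1 ?(ltW y0)//.
rewrite mulrAC -powRD; last by rewrite (gt_eqF x0) implybT.
rewrite -mulrDl subrr mul0r powRr0 mul1r.
rewrite mulrAC (mulrC b^-1) -mulrDl ler_pdivlMr// mulNr.
lra.
Qed.

Lemma le0_ger_powR r u v : r <= 0 -> 0 < u -> u <= v -> v `^ r <= u `^ r.
Proof.
move=> r0 u0 uv; have v0 := lt_le_trans u0 uv.
rewrite -(opprK r) !(powRN _ (- r)) lef_pV2 ?posrE ?powR_gt0//.
by rewrite ge0_ler_powR ?nnegrE ?oppr_ge0// ltW.
Qed.

Lemma ge0_le_powR r u v : 0 <= r -> 0 <= u -> u <= v -> u `^ r <= v `^ r.
Proof.
by move=> r0 u0 uv; apply: ge0_ler_powR => //; rewrite nnegrE// (le_trans u0).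
Qed.

Lemma pmean_ge0 lam p u v : 0 <= u -> 0 <= v -> 0 <= pmean lam p u v.
Proof.
move=> u0 v0; rewrite /pmean; case: ifPn => // _.
case: p => [r| |].
- by case: ifPn => _; rewrite ?mulr_ge0 ?powR_ge0.
- by rewrite le_max u0.
- by rewrite le_min u0.
Qed.

Lemma pmean_eq0 lam p u v : u * v = 0 -> pmean lam p u v = 0.
Proof. by move=> /eqP uv; rewrite /pmean uv. Qed.

Lemma pmean_homo lam p c u v : 0 < c -> 0 <= u -> 0 <= v ->
  0 < lam < 1 -> pmean lam p (c * u) (c * v) = c * pmean lam p u v.
Proof.
move=> c0 u0 v0 /andP[l0 l1]; rewrite /pmean mulrACA mulf_eq0 mulf_eq0 orbb gt_eqF//=.
case: ifPn => [_|uv]; first by rewrite mulr0.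
case: p => [r| |].
- case: eqVneq => [_|r0].
    rewrite !powRM ?(ltW c0)// mulrACA -powRD ?(gt_eqF c0) ?implybT//.
    by rewrite subrK powRr1// ltW.
  rewrite !powRM ?(ltW c0)// !(mulrCA _ (c `^ r)) -mulrDr powRM ?powR_ge0//.
    by rewrite -powRrM divff// powRr1// ltW.
  by rewrite addr_ge0 ?mulr_ge0 ?powR_ge0 ?subr_ge0 ?ltW.
- by rewrite maxr_pMr// ltW.
- by rewrite minr_pMr// ltW.
Qed.

Lemma convex_comb_gt0 lam x y : 0 < lam < 1 -> 0 < x -> 0 < y ->
  0 < (1 - lam) * x + lam * y.
Proof. by move=> /andP[? ?] ? ?; rewrite addr_gt0 ?mulr_gt0 ?subr_gt0. Qed.

Lemma pmean_gt0 lam p u v : 0 < lam < 1 -> 0 < u -> 0 < v -> 0 < pmean lam p u v.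
Proof.
move=> ll u0 v0; rewrite /pmean gt_eqF ?mulr_gt0//.
case: p => [r| |].
- case: ifPn => _; first by rewrite mulr_gt0 ?powR_gt0.
  by rewrite powR_gt0// convex_comb_gt0// powR_gt0.
- by rewrite lt_max u0.
- by rewrite lt_min u0.
Qed.

Lemma le_pmean lam p u v u' v' : 0 < lam < 1 -> 0 <= u -> 0 <= v ->
  u <= u' -> v <= v' -> pmean lam p u v <= pmean lam p u' v'.
Proof.
move=> ll; rewrite le_eqVlt => /predU1P[<- v0 u'0 vv'|u0].
  by rewrite [leLHS]pmean_eq0 ?mul0r// pmean_ge0// (le_trans v0).
rewrite le_eqVlt => /predU1P[<- uu' v'0|v0 uu' vv'].
  by rewrite [leLHS]pmean_eq0 ?mulr0// pmean_ge0// (le_trans (ltW u0)).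
have u'0 := lt_le_trans u0 uu'; have v'0 := lt_le_trans v0 vv'.
have /andP[l0 l1] := ll.
rewrite /pmean !gt_eqF ?mulr_gt0//.
case: p => [r| |].
- have l1' : 0 <= 1 - lam by rewrite subr_ge0 ltW.
  have [u1 v1] := (ltW u0, ltW v0).
  case: ifPn => r0.
    by rewrite ler_pM ?powR_ge0// ge0_le_powR// ltW.
  have [{}r0|{}r0] := ltP r 0.
    apply: le0_ger_powR; rewrite ?invr_le0 ?(ltW r0)//.
      by rewrite convex_comb_gt0 ?powR_gt0.
    by rewrite lerD// ler_wpM2l ?(ltW l0)//; apply: le0_ger_powR; rewrite ?(ltW r0).
  apply: ge0_le_powR; first by rewrite invr_ge0.
    by rewrite addr_ge0 ?mulr_ge0 ?powR_ge0 ?(ltW l0).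
  by rewrite lerD// ler_wpM2l ?(ltW l0)//; apply: ge0_le_powR.
- by rewrite ge_max !le_max uu' vv' orbT.
- by rewrite le_min !ge_min uu' vv' orbT.
Qed.

(** Homogeneity replaces a continuity argument by cases on p: both arguments are shrunk by one
    factor [c], the midpoint of s/m and 1. *)
Lemma pmean_lt_lsc lam p s u v : 0 < lam < 1 -> 0 <= s -> 0 <= u -> 0 <= v ->
  s < pmean lam p u v ->
  exists u' v', [/\ 0 < u', 0 < v', u' < u, v' < v & s < pmean lam p u' v'].
Proof.
move=> ll s0; rewrite le_eqVlt => /predU1P[<-|u0].
  by rewrite pmean_eq0 ?mul0r// ltNge s0.
rewrite le_eqVlt => /predU1P[<-|v0].
  by rewrite pmean_eq0 ?mulr0// ltNge s0.
set m := pmean _ _ _ _ => sm.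
have m0 : 0 < m by apply: le_lt_trans sm.
pose c := (s / m + 1) / 2.
have sm1 : s / m < 1 by rewrite ltr_pdivrMr ?mul1r.
have smc : s / m < c by rewrite /c midf_lt.
have c1 : c < 1 by rewrite /c midf_lt.
have c0 : 0 < c by apply: le_lt_trans smc; rewrite divr_ge0// ltW.
exists (c * u), (c * v); split; rewrite ?(mulr_gt0 c0) ?gtr_pMl//.
by rewrite pmean_homo ?(ltW u0) ?(ltW v0)//; rewrite ltr_pdivrMr in smc.
Qed.

End power_means.

(** * Means of volumes and Hoelder's inequality *)

Section root_mean.
Context (R : realType) (n : nat).
Implicit Types (a b c lam r s t u v w x y : R) (p : \bar R).
Local Notation d := (n.+1%:R : R).

(** The volume of (1 - lam) A + lam B for dilates A, B of one convex body with volumes x, y. Unlike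
    [pmean] with exponent 1/d, it does not vanish when only one argument is 0. *)
Definition root_mean lam x y : R :=
  ((1 - lam) * x `^ d^-1 + lam * y `^ d^-1) ^+ n.+1.

(** The defect at each induction step is lam (1 - lam) (s - t) (s^m - t^m), a product of differences
    of equal sign. *)
Lemma convex_comb_exprn lam s t (m : nat) : 0 <= lam <= 1 -> 0 <= s -> 0 <= t ->
  ((1 - lam) * s + lam * t) ^+ m <= (1 - lam) * s ^+ m + lam * t ^+ m.
Proof.
move=> /andP[l0 l1] s0 t0; elim: m => [|m ih]; first by rewrite !expr0; lra.
have st : 0 <= (s - t) * (s ^+ m - t ^+ m).
  have [ts|/ltW ts] := leP t s.
    by rewrite mulr_ge0 ?subr_ge0// lerXn2r.
  by rewrite mulr_le0 ?subr_le0// lerXn2r.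
have c0 : 0 <= (1 - lam) * s + lam * t.
  by rewrite addr_ge0 ?mulr_ge0 ?subr_ge0.
rewrite exprS; apply: le_trans (ler_wpM2l c0 ih) _.
rewrite -subr_ge0 !exprS.
have -> : (1 - lam) * (s * s ^+ m) + lam * (t * t ^+ m) -
   ((1 - lam) * s + lam * t) * ((1 - lam) * s ^+ m + lam * t ^+ m) =
   lam * (1 - lam) * ((s - t) * (s ^+ m - t ^+ m)) by ring.
by rewrite mulr_ge0// mulr_ge0 ?subr_ge0.
Qed.

Lemma powR_rootK x : 0 <= x -> (x `^ d^-1) ^+ n.+1 = x.
Proof.
by move=> x0; rewrite -powR_mulrn ?powR_ge0// -powRrM mulVf ?pnatr_eq0// powRr1.
Qed.

Lemma exprK_powR x : 0 <= x -> (x ^+ n.+1) `^ d^-1 = x.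
Proof.
by move=> x0; rewrite -powR_mulrn// -powRrM mulfV ?pnatr_eq0// powRr1.
Qed.

Lemma root_mean_base_ge0 lam x y : 0 < lam < 1 ->
  0 <= (1 - lam) * x `^ d^-1 + lam * y `^ d^-1.
Proof.
move=> /andP[l0 l1];
  rewrite addr_ge0 ?mulr_ge0 ?powR_ge0 ?subr_ge0 ?(ltW l1) ?(ltW l0)//.
Qed.

Lemma root_mean_ge0 lam x y : 0 < lam < 1 -> 0 <= root_mean lam x y.
Proof. by move=> ll; rewrite exprn_ge0// root_mean_base_ge0. Qed.

(* Dividing by [root_mean (x + a) (y + b)], each term on the left becomes the
   d-th power of a convex combination, to which Jensen's inequality applies. *)
Lemma root_mean_superadditive lam x y a b : 0 < lam < 1 ->
  0 <= x -> 0 <= y -> 0 <= a -> 0 <= b ->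
  root_mean lam x y + root_mean lam a b <= root_mean lam (x + a) (y + b).
Proof.
move=> ll x0 y0 a0 b0; have /andP[l0 l1] := ll.
have l1' : 0 < 1 - lam by rewrite subr_gt0.
(* Normalising would divide by 0 when one coordinate vanishes in both pairs, but then [root_mean] is
   linear in the other coordinate. *)
have sgl z z' (m : R) : 0 <= z -> 0 <= z' ->
    (m * z `^ d^-1) ^+ n.+1 + (m * z' `^ d^-1) ^+ n.+1 =
    (m * (z + z') `^ d^-1) ^+ n.+1.
  by move=> z0 z'0; rewrite !exprMn !powR_rootK ?addr_ge0// -mulrDr.
have rt0 : (0 : R) `^ d^-1 = 0 by rewrite powR0.
have [X0|X0] := eqVneq (x + a) 0.
  have /andP[/eqP -> /eqP ->] : (x == 0) && (a == 0) by rewrite -paddr_eq0// X0.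
  by rewrite /root_mean addr0 rt0 mulr0 !add0r sgl.
have [Y0|Y0] := eqVneq (y + b) 0.
  have /andP[/eqP -> /eqP ->] : (y == 0) && (b == 0) by rewrite -paddr_eq0// Y0.
  by rewrite /root_mean addr0 rt0 mulr0 !addr0 sgl.
have {}X0 : 0 < x + a by rewrite lt_def X0 addr_ge0.
have {}Y0 : 0 < y + b by rewrite lt_def Y0 addr_ge0.
set t := (1 - lam) * (x + a) `^ d^-1 + lam * (y + b) `^ d^-1.
have t0 : 0 < t by rewrite convex_comb_gt0 ?powR_gt0.
pose w := lam * (y + b) `^ d^-1 / t.
have w1 : 1 - w = (1 - lam) * (x + a) `^ d^-1 / t.
  apply: (mulIf (lt0r_neq0 t0)); rewrite mulrBl mul1r !divfK ?gt_eqF//.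
  by rewrite /t addrK.
have w01 : 0 <= w <= 1.
  rewrite -(subr_ge0 w 1) w1 !divr_ge0 ?(ltW t0)// mulr_ge0 ?powR_ge0 ?(ltW l0)
    ?(ltW l1')//.
have key z z' : 0 <= z -> 0 <= z' ->
  root_mean lam z z' <= t ^+ n.+1 * ((1 - w) * (z / (x + a)) + w * (z' / (y + b))).
  move=> z0 z'0; rewrite /root_mean.
  have -> : (1 - lam) * z `^ d^-1 + lam * z' `^ d^-1 =
     t * ((1 - w) * (z / (x + a)) `^ d^-1 + w * (z' / (y + b)) `^ d^-1).
    rewrite -{1}(divfK (lt0r_neq0 X0) z) -{1}(divfK (lt0r_neq0 Y0) z').
    rewrite !powRM ?divr_ge0 ?invr_ge0 ?(ltW X0) ?(ltW Y0)// w1 /w.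
    by field; rewrite gt_eqF.
  rewrite exprMn ler_wpM2l ?exprn_ge0 ?(ltW t0)//.
  apply: le_trans (convex_comb_exprn _ w01 _ _) _; rewrite ?powR_ge0//.
  by rewrite !powR_rootK ?divr_ge0 ?(ltW X0) ?(ltW Y0).
apply: le_trans (lerD (key _ _ x0 y0) (key _ _ a0 b0)) _.
rewrite -mulrDr /root_mean -/t ger_pMr ?exprn_gt0//.
rewrite addrACA -!mulrDr -!mulrDl !mulfV ?gt_eqF// !mulr1; lra.
Qed.

(** Homogeneity allows normalising to (1 - lam) X + lam Y = 1, with X = x^(1/d)/A and Y = y^(1/d)/A,
    and to [pmean lam p a' b'] = 1. What remains is that the q-mean of X^d a' and Y^d b' is at most
    1, which Young's inequality gives term by term. *)
Lemma root_mean_hoelder lam p x y a b : 0 < lam < 1 -> ((- d^-1)%:E <= p)%E ->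
  0 <= x -> 0 <= y -> 0 < a -> 0 < b ->
  pmean lam (mean_exponent n.+1 p) (x * a) (y * b) <=
  root_mean lam x y * pmean lam p a b.
Proof.
move=> ll hp; rewrite le_eqVlt => /predU1P[<- y0 a0 b0|x0].
  by rewrite mul0r pmean_eq0 ?mul0r// mulr_ge0 ?root_mean_ge0// pmean_ge0// ltW.
rewrite le_eqVlt => /predU1P[<- a0 b0|y0 a0 b0].
  by rewrite mul0r pmean_eq0 ?mulr0// mulr_ge0 ?root_mean_ge0// pmean_ge0// ltW.
have /andP[l0 l1] := ll; have l1' : 0 < 1 - lam by rewrite subr_gt0.
have d0 : 0 < d by [].
set A := (1 - lam) * x `^ d^-1 + lam * y `^ d^-1.
have A0 : 0 < A by rewrite convex_comb_gt0 ?powR_gt0.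
have TE : root_mean lam x y = A ^+ n.+1 by [].
case: p hp => [r| |]/= hr; last 2 first.
- rewrite /pmean !gt_eqF ?mulr_gt0//= ?invr_gt0//.
  rewrite invrK powR_mulrn; last first.
    by rewrite addr_ge0// mulr_ge0 ?powR_ge0 ?(ltW l0) ?(ltW l1').
  rewrite TE -[leRHS]powR_rootK; last first.
    by rewrite mulr_ge0 ?exprn_ge0 ?(ltW A0)// le_max (ltW a0).
  have M0 : 0 <= Num.max a b by rewrite le_max (ltW a0).
  rewrite [(A ^+ n.+1 * _) `^ _]powRM ?exprn_ge0 ?(ltW A0)// exprK_powR ?(ltW A0)//.
  rewrite lerXn2r ?nnegrE ?mulr_ge0 ?powR_ge0 ?(ltW A0)//.
    by rewrite addr_ge0// mulr_ge0 ?powR_ge0 ?(ltW l0) ?(ltW l1').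
  rewrite /A [leRHS]mulrDl -!mulrA !powRM ?(ltW x0) ?(ltW y0) ?(ltW a0) ?(ltW b0)//.
  rewrite lerD// ler_wpM2l ?(ltW l0) ?(ltW l1')// ler_wpM2l ?powR_ge0//;
    by rewrite ge0_le_powR ?invr_ge0 ?(ltW a0) ?(ltW b0)// le_max lexx ?orbT.
- by move: hr; rewrite leeNy_eq.
rewrite lee_fin in hr; rewrite TE.
have xE : x = A ^+ n.+1 * (x `^ d^-1 / A) ^+ n.+1.
  by rewrite -exprMn mulrC divfK ?gt_eqF// powR_rootK// ltW.
have yE : y = A ^+ n.+1 * (y `^ d^-1 / A) ^+ n.+1.
  by rewrite -exprMn mulrC divfK ?gt_eqF// powR_rootK// ltW.
set X := x `^ d^-1 / A in xE; set Y := y `^ d^-1 / A in yE.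
have X0 : 0 < X by rewrite divr_gt0 ?powR_gt0.
have Y0 : 0 < Y by rewrite divr_gt0 ?powR_gt0.
have XY1 : (1 - lam) * X + lam * Y = 1.
  by rewrite /X /Y !mulrA -mulrDl mulfV// gt_eqF.
set B := pmean lam r%:E a b.
have B0 : 0 < B by rewrite pmean_gt0.
set q := (if _ then _ else _).
have AB0 : 0 < A ^+ n.+1 * B by rewrite mulr_gt0 ?exprn_gt0.
pose a' := a / B; pose b' := b / B.
have a'0 : 0 < a' by rewrite divr_gt0.
have b'0 : 0 < b' by rewrite divr_gt0.
have -> : x * a = (A ^+ n.+1 * B) * (X ^+ n.+1 * a').
  by rewrite {1}xE -!mulrA; congr (_ * _); rewrite mulrCA (mulrC B) divfK// gt_eqF.
have -> : y * b = (A ^+ n.+1 * B) * (Y ^+ n.+1 * b').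
  by rewrite {1}yE -!mulrA; congr (_ * _); rewrite mulrCA (mulrC B) divfK// gt_eqF.
have B1 : pmean lam r%:E a' b' = 1.
  rewrite /a' /b' !(mulrC _ B^-1) pmean_homo ?invr_gt0 ?(ltW a0) ?(ltW b0)//.
  by rewrite mulVf// gt_eqF.
clearbody a' b' X Y.
have Xn0 := exprn_gt0 n.+1 X0; have Yn0 := exprn_gt0 n.+1 Y0.
rewrite pmean_homo ?mulr_ge0 ?(ltW Xn0) ?(ltW Yn0) ?(ltW a'0) ?(ltW b'0)//.
rewrite ger_pMr//.
(* Here r = -1/d and q is minus infinity. If both X^d a' and Y^d b' exceeded 1, then a'^r < X and
   b'^r < Y, so the r-mean of a' and b' would exceed 1. *)
rewrite /q; case: eqP => [rE|/eqP rN].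
  rewrite /pmean gt_eqF ?mulr_gt0//.
  rewrite leNgt; apply/negP; rewrite lt_min => /andP[h1 h2].
  have r0 : r < 0 by rewrite rE oppr_lt0 invr_gt0.
  have c1 : X^-1 ^+ n.+1 < a' by rewrite exprVn -[ltLHS]mulr1 ltr_pdivrMl.
  have c2 : Y^-1 ^+ n.+1 < b' by rewrite exprVn -[ltLHS]mulr1 ltr_pdivrMl.
  have k z z' : 0 < z -> z^-1 ^+ n.+1 < z' -> z' `^ r < z.
    move=> z0 zz'; have z'0 : 0 < z' by apply: lt_trans zz';
      rewrite exprn_gt0 ?invr_gt0.
    rewrite rE powRN -[ltRHS]invrK ltf_pV2 ?posrE ?powR_gt0 ?invr_gt0//.
    rewrite -[ltLHS]exprK_powR ?invr_ge0 ?(ltW z0)//.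
    by apply: gt0_ltr_powR;
      rewrite ?invr_gt0 ?nnegrE ?exprn_ge0 ?invr_ge0 ?(ltW z0) ?(ltW z'0).
  have : (1 - lam) * a' `^ r + lam * b' `^ r < 1.
    by rewrite -[ltRHS]XY1 ltrD// ltr_pM2l// k.
  move=> ab; suff : 1 < pmean lam r%:E a' b' by rewrite B1 ltxx.
  have S0 : 0 < (1 - lam) * a' `^ r + lam * b' `^ r.
    by rewrite convex_comb_gt0 ?powR_gt0.
  have rV : r^-1 = - d by rewrite rE invrN invrK.
  rewrite /pmean gt_eqF ?mulr_gt0//= (lt_eqF r0) rV powRN powR_mulrn ?(ltW S0)//.
  by rewrite invf_gt1 ?exprn_gt0// exprn_ilt1// ltW.
have rd : 0 < d * r + 1.
  have : - d^-1 < r by rewrite lt_def rN.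
  rewrite -(ltr_pM2l d0) mulrN mulfV ?gt_eqF// => ?; lra.
case: (eqVneq r 0) => [r0|r0].
  rewrite r0 mul0r; move: B1; rewrite r0 /pmean/= eqxx !gt_eqF ?mulr_gt0// => B1.
  rewrite !powRM ?(ltW Xn0) ?(ltW Yn0) ?(ltW a'0) ?(ltW b'0)// mulrACA B1 mulr1.
  rewrite -!powR_mulrn ?(ltW X0) ?(ltW Y0)// -!powRrM !(mulrC d) !powRrM.
  rewrite -powRM ?powR_ge0// powR_mulrn ?mulr_ge0 ?powR_ge0//.
  rewrite exprn_ile1 ?mulr_ge0 ?powR_ge0// -[leRHS]XY1 young_powR ?(ltW l1')
    ?(ltW l0)//.
  by rewrite subrK.
have q0 : r / (d * r + 1) != 0 by rewrite mulf_neq0// invr_neq0// gt_eqF.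
(* (X^d a')^q = X^al (a'^r)^be with al + be = 1. The sign of al is that of r: for r < 0 Young's
   inequality is reversed, and so is the monotonicity of the outer power 1/q. *)
pose al := d * r / (d * r + 1); pose be := (d * r + 1)^-1.
have albe : al + be = 1 by rewrite /al /be -[X in _ + X]mul1r -mulrDl mulfV// gt_eqF.
have be0 : 0 < be by rewrite invr_gt0.
have powE z z' : 0 < z -> 0 < z' -> (z ^+ n.+1 * z') `^ (r / (d * r + 1)) =
   z `^ al * (z' `^ r) `^ be.
  move=> z0 z'0; rewrite powRM ?exprn_ge0 ?(ltW z0) ?(ltW z'0)//.
  by rewrite -powR_mulrn ?(ltW z0)// -!powRrM mulrA.
move: B1; rewrite /pmean/= (negbTE q0) (negbTE r0) !gt_eqF ?mulr_gt0// => B1.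
have {}B1 : (1 - lam) * a' `^ r + lam * b' `^ r = 1.
  move/(congr1 (fun z => z `^ r)): B1.
  rewrite powR1 -powRrM mulVf// powRr1// addr_ge0// mulr_ge0 ?powR_ge0//.
    exact: ltW.
  exact: ltW.
rewrite !powE//.
have S1 : (1 - lam) * (al * X + be * a' `^ r) + lam * (al * Y + be * b' `^ r) = 1.
  transitivity (al * ((1 - lam) * X + lam * Y) +
    be * ((1 - lam) * a' `^ r + lam * b' `^ r)); first by ring.
  by rewrite XY1 B1 !mulr1.
have one1 : 1 `^ (r / (d * r + 1))^-1 = 1 :> R by rewrite powR1.
have [r1|r1] := ltP r 0.
  have al0 : al <= 0 by rewrite /al pmulr_lle0 ?invr_gt0// pmulr_rle0// ltW.
  rewrite -[leRHS]one1.
  apply: le0_ger_powR => //.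
    by rewrite invr_le0 pmulr_lle0 ?invr_gt0// ltW.
  by rewrite -[leLHS]S1 lerD// ler_wpM2l ?(ltW l0)
    ?(ltW l1')// young_powR_neg// powR_gt0//.
have {}r1 : 0 < r by rewrite lt_def r0.
have al0 : 0 <= al by rewrite divr_ge0 ?mulr_ge0// ltW.
rewrite -[leRHS]one1.
apply: ge0_le_powR.
- by rewrite invr_ge0 divr_ge0// ltW.
- by rewrite addr_ge0// mulr_ge0 ?mulr_ge0 ?powR_ge0 ?(ltW l0) ?(ltW l1').
- by rewrite -[leRHS]S1 lerD// ler_wpM2l ?(ltW l0) ?(ltW l1')// young_powR
  ?powR_gt0// ltW.
Qed.

End root_mean.

(** * Means of extended reals *)

Section extended_mean.
Context (R : realType) (lam : R).
Hypothesis ll : 0 < lam < 1.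
Implicit Types (s u v : R) (p x y : \bar R).
Local Open Scope ereal_scope.

Lemma epmean_ge0 p x y : 0 <= x -> 0 <= y -> 0 <= epmean lam p x y.
Proof.
case: x => [u| |]; case: y => [v| |] //= u0 v0;
  try by apply: ereal_sup_ubound; left.
by rewrite lee_fin pmean_ge0.
Qed.

(** With [pmean_le_epmean] and [epmean_le], this spares later proofs any distinction between finite
    and infinite arguments. *)
Lemma lt_epmeanP p s x y : (0 <= s)%R -> 0 <= x -> 0 <= y ->
  s%:E < epmean lam p x y ->
  exists u v, [/\ (0 < u)%R, (0 < v)%R, u%:E < x, v%:E < y &
                  (s < pmean lam p u v)%R].
Proof.
move=> s0 x0 y0.
suff: s%:E < epmean lam p x y ->
  exists u v, [/\ (0 <= u)%R, (0 <= v)%R, u%:E <= x, v%:E <= y &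
                  (s < pmean lam p u v)%R].
  move=> h /h[u [v [u0 v0 ux vy suv]]].
  have [u' [v' [u'0 v'0 u'u v'v ?]]] := pmean_lt_lsc ll s0 u0 v0 suv.
  by exists u', v'; split => //; [apply: lt_le_trans ux|apply: lt_le_trans vy].
have gen : s%:E < ereal_sup ([set 0%E] `|`
      [set (pmean lam p w.1 w.2)%:E | w in [set w : R * R |
        [/\ (0 <= w.1)%R, (0 <= w.2)%R, w.1%:E < x & w.2%:E < y]]]) ->
  exists u v, [/\ (0 <= u)%R, (0 <= v)%R, u%:E <= x, v%:E <= y &
                  (s < pmean lam p u v)%R].
  move=> /ereal_sup_gt[_ [->|[[u v]/= [u0 v0 ux vy] <-]]].
    by rewrite lte_fin ltNge s0.
  by rewrite lte_fin => suv; exists u, v; split => //; exact: ltW.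
case: x x0 gen => [u| |] x0 gen //; case: y y0 gen => [v| |] y0 gen //.
by rewrite /= lte_fin => suv; exists u, v; split.
Qed.

Lemma pmean_le_epmean p u v x y : (0 <= u)%R -> (0 <= v)%R ->
  u%:E <= x -> v%:E <= y -> (pmean lam p u v)%:E <= epmean lam p x y.
Proof.
rewrite le_eqVlt => /predU1P[<- v0 ux vy|u0].
  by rewrite pmean_eq0 ?mul0r// epmean_ge0// (le_trans _ vy).
rewrite le_eqVlt => /predU1P[<- ux vy|v0 ux vy].
  by rewrite pmean_eq0 ?mulr0// epmean_ge0// (le_trans _ ux)// lee_fin ltW.
suff gen : (pmean lam p u v)%:E <= ereal_sup ([set 0%E] `|`
      [set (pmean lam p w.1 w.2)%:E | w in [set w : R * R |
        [/\ (0 <= w.1)%R, (0 <= w.2)%R, w.1%:E < x & w.2%:E < y]]]).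
  case: x y ux vy gen => [u'| |] [v'| |]//.
  by rewrite /= !lee_fin => uu vv _; rewrite le_pmean// ltW.
(* The supremum admits only strictly smaller points; were it below the mean at (u, v),
   [pmean_lt_lsc] would produce such a point with a larger mean. *)
set I := ereal_sup _; rewrite leNgt; apply/negP => hI.
have I0 : 0 <= I by apply: ereal_sup_ubound; left.
have If : I \is a fin_num by rewrite ge0_fin_numE// (lt_trans hI) ?ltry.
move: hI; rewrite -(fineK If) lte_fin => hI.
have [u' [v' [u'0 v'0 u'u v'v ?]]] :=
  pmean_lt_lsc ll (fine_ge0 I0) (ltW u0) (ltW v0) hI.
suff : (pmean lam p u' v')%:E <= I.
  by rewrite -(fineK If) lee_fin leNgt => /negP.
apply: ereal_sup_ubound; right; exists (u', v') => //=; split.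
- exact: ltW.
- exact: ltW.
- by rewrite (lt_le_trans _ ux).
- by rewrite (lt_le_trans _ vy).
Qed.

Lemma epmean_le p x y (I : \bar R) : 0 <= x -> 0 <= y -> 0 <= I ->
  (forall u v, (0 < u)%R -> (0 < v)%R -> u%:E < x -> v%:E < y ->
     (pmean lam p u v)%:E <= I) ->
  epmean lam p x y <= I.
Proof.
move=> x0 y0 I0 h; rewrite leNgt; apply/negP => hI.
have If : I \is a fin_num by rewrite ge0_fin_numE// (lt_le_trans hI) ?leey.
move: hI; rewrite -(fineK If) => hI.
have [u [v [u0 v0 ux vy suv]]] := lt_epmeanP (fine_ge0 I0) x0 y0 hI.
have := h _ _ u0 v0 ux vy.
by rewrite -(fineK If) lee_fin leNgt suv.
Qed.

End extended_mean.

(** * Volume of boxes *)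

Section box_volume.
Context (R : realType).
Local Open Scope ereal_scope.

(** Neither function has to be measurable, because every simple function below [f1] on [D] is also
    below [f2]. *)
Lemma ge0_le_integral_lower d (T : measurableType d)
    (mu : {measure set T -> \bar R}) (D : set T) (f1 f2 : T -> \bar R) :
  (forall x, D x -> 0 <= f1 x) -> (forall x, D x -> f1 x <= f2 x) ->
  \int[mu]_(x in D) f1 x <= \int[mu]_(x in D) f2 x.
Proof.
move=> f10 f12; have f20 x : D x -> 0 <= f2 x.
  by move=> Dx; apply: le_trans (f10 _ Dx) (f12 _ Dx).
rewrite !ge0_integralE//; apply: ereal_sup_le => _ [h hf <-]; exists h => //= x.
apply: le_trans (hf x) _; rewrite /patch; case: ifPn => // /set_mem; exact: f12.
Qed.

(* Induction on the number of coordinates: integrate out the last one. *)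
Lemma prod_volume_cover (m : nat) (a b : nat -> R) (c e : nat -> nat -> R)
    (al : nat -> R) (be : R) :
  (forall k, (0 <= al k)%R) -> (0 <= be)%R ->
  (forall x : nat -> R, (forall i, (i < m)%N -> (a i < x i <= b i)%R) ->
     be%:E <= \sum_(k <oo)
       (al k * \prod_(i < m) \1_`]c k i, e k i] (x i))%:E) ->
  (be * \prod_(i < m) Num.max 0 (b i - a i))%:E <=
  \sum_(k <oo) (al k * \prod_(i < m) Num.max 0 (e k i - c k i))%:E.
Proof.
elim: m al be => [|m ih] al be al0 be0 h.
  have := h a (fun i => ltac:(by [])).
  under eq_eseriesr do rewrite big_ord0.
  by under [in X in _ -> X]eq_eseriesr do rewrite big_ord0; rewrite big_ord0 mulr1.
pose P k : R := (\prod_(i < m) Num.max 0 (e k i - c k i))%R.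
have P0 k : (0 <= P k)%R by apply: prodr_ge0 => i _; rewrite le_max lexx.
pose I := `]a m, b m]%classic.
have mI : measurable I by exact: measurable_itv.
(* The weights [al] are general so that the induction hypothesis applies to the slice at height t,
   with the indicators of the last coordinate absorbed into them. *)
have step t : I t -> (be * \prod_(i < m) Num.max 0 (b i - a i))%:E <=
    \sum_(k <oo) (al k * P k * \1_`]c k m, e k m] t)%:E.
  move=> It.
  apply: (@le_trans _ _ (\sum_(k <oo) ((al k * \1_`]c k m, e k m] t) * P k)%:E));
    last first.
    by apply: lee_nneseries => k *; rewrite lee_fin ?mulr_ge0// mulrAC.
  apply: ih => // [k|x xab]; first by rewrite mulr_ge0.
  pose x' i := if i == m then t else x i.
  have := h x'.
  have -> : (\sum_(k <oo) (al k * (\prod_(i < m.+1) \1_(`]c k i, e k i]) (x' i)))%:E) =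
    (\sum_(k <oo) ((al k * \1_`]c k m, e k m] t) *
       (\prod_(i < m) \1_(`]c k i, e k i]) (x i)))%:E).
    apply: eq_eseriesr => k _; congr (_%:E).
    rewrite big_ord_recr/= {2}/x' eqxx -!mulrA; congr (_ * _)%R; rewrite mulrC.
    by congr (_ * _)%R; apply: eq_bigr => i _; rewrite /x' ltn_eqF.
  apply => i; rewrite ltnS leq_eqVlt => /predU1P[->|im].
    by rewrite /x' eqxx; move: It; rewrite /I/= in_itv.
  by rewrite /x' ltn_eqF// xab.
have lI (u v : R) : lebesgue_measure (`]u, v]%classic : set R) = (Num.max 0 (v - u))%:E.
  rewrite lebesgue_measure_itv/= lte_fin; case: ltP => uv.
    by rewrite max_r// subr_ge0 ltW.
  by rewrite max_l// subr_le0.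
rewrite big_ord_recr/= mulrA EFinM -lI -integral_cst//.
apply: (@le_trans _ _ (\int[lebesgue_measure]_(t in I)
    \sum_(k <oo) (al k * P k * \1_`]c k m, e k m] t)%:E)).
  apply: ge0_le_integral_lower => [t _|t It]; last exact: step.
  by rewrite lee_fin mulr_ge0// prodr_ge0// => i _; rewrite le_max lexx.
have mm k : measurable_fun I (EFin \o
  (fun t : R => al k * P k * \1_`]c k m, e k m] t)%R).
  apply/measurable_EFinP; apply: measurable_funM.
    exact: measurable_cst.
  by apply: measurable_indic; exact: measurable_itv.
rewrite [leLHS](_ : _ = \sum_(k <oo) \int[lebesgue_measure]_(t in I)
    (al k * P k * \1_`]c k m, e k m] t)%:E); last first.
  apply: (integral_nneseries lebesgue_measure mI mm).
  by move=> k t _; rewrite lee_fin !mulr_ge0.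
apply: lee_nneseries => [k _ _|k _].
  by apply: integral_ge0 => t _; rewrite lee_fin !mulr_ge0.
under eq_integral do rewrite EFinM.
rewrite ge0_integralZl_EFin ?mulr_ge0//; last first.
  by apply/measurable_EFinP; apply: measurable_indic; exact: measurable_itv.
rewrite integral_indic// big_ord_recr/= mulrA [leRHS]EFinM -lI lee_wpmul2l//.
  by rewrite lee_fin mulr_ge0.
by rewrite le_measure ?inE//; apply: measurableI.
Qed.

End box_volume.

(** * Outer measure of boxes and measurability of Borel sets *)

Section lebesgue_outer.
Context (R : realType) (n : nat).
Local Notation V := 'rV[R]_n.+1.
Implicit Types (b : V * V) (A X : set V) (i : 'I_n.+1) (t : R).
Local Notation mu := (@lebesgue_outer R n).

(** A cover by boxes means that their indicators sum to at least 1 on [box b], which is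
    [prod_volume_cover] with all weights 1; [inord] translates its coordinates, indexed by nat. *)
Lemma lebesgue_outer_box_ge b : ((box_volume b)%:E <= mu (box b))%E.
Proof.
apply: le_ereal_inf_tmp => _ [c /= bc <-].
have := @prod_volume_cover R n.+1 (fun k => b.1 ord0 (inord k))
  (fun k => b.2 ord0 (inord k)) (fun k l => (c k).1 ord0 (inord l))
  (fun k l => (c k).2 ord0 (inord l)) (fun=> 1) 1 (fun=> ler01) ler01.
rewrite mul1r; under eq_bigr do rewrite inord_val.
rewrite -/(box_volume b).
under [X in _ -> (_ <= X)%E]eq_eseriesr => k _.
  rewrite mul1r; under eq_bigr do rewrite inord_val.
  rewrite -/(box_volume (c k)); over.
apply => x xb.
pose y : V := \row_l x l.
have /bc[k _ yk] : box b y.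
  by move=> l; rewrite /y mxE; have := xb l (ltn_ord l); rewrite !inord_val.
have h0 j : (0 <= (1 * \prod_(l < n.+1)
    \1_(`](c j).1 ord0 (inord l), (c j).2 ord0 (inord l)]) (x l))%:E :> \bar R)%E.
  by rewrite lee_fin mul1r prodr_ge0.
apply: le_trans (nneseries_lim_ge k.+1 _) => //.
rewrite big_nat_recr//= -[leLHS]add0e leeD//.
  by apply: sume_ge0 => *.
rewrite mul1r big1// => l _; rewrite indicE mem_set// inord_val /= in_itv/=.
by have := yk l; rewrite /y mxE.
Qed.

Lemma lebesgue_outer_box b : mu (box b) = (box_volume b)%:E.
Proof.
apply/eqP; rewrite eq_le lebesgue_outer_box_ge andbT.
apply: ereal_inf_lbound => /=.
exists (fun k => if k == 0%N then b else (0, 0)) => /=.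
  by move=> x bx; exists 0%N.
rewrite nneseries_recl//; last by move=> k _; rewrite lee_fin box_volume_ge0.
rewrite /= eseries0 ?adde0// => -[|k]// _ _; congr (_%:E).
by rewrite /box_volume big_ord_recl/= subrr maxxx mul0r.
Qed.

Lemma lebesgue_outer_boxes (s : seq (V * V)) A :
  (forall x, A x -> exists2 b, b \in s & box b x) ->
  (mu A <= (\sum_(b <- s) box_volume b)%:E)%E.
Proof.
elim: s A => [|b s ih] A sA.
  by rewrite big_nil (_ : A = set0) ?lebesgue_outer0//; apply/seteqP;
    split => x// /sA[].
rewrite big_cons EFinD -lebesgue_outer_box.
apply: (@le_trans _ _ (mu ((A `&` box b) `|` (A `&` ~` box b)))).
  by rewrite -setIUr setUCr setIT.
apply: le_trans (outer_measureU2 _ _ _) _; apply: leeD.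
  by apply: le_lebesgue_outer; exact: subIsetr.
apply: ih => x [/sA[b' + bx] nbx]; rewrite inE => /predU1P[bb|? ]; last by exists b'.
by case: nbx; rewrite -bb.
Qed.

Definition box_left i t b : V * V :=
  (b.1, \row_j if j == i then Num.min (b.2 ord0 j) t else b.2 ord0 j).
Definition box_right i t b : V * V :=
  (\row_j (if j == i then Num.max (b.1 ord0 j) t else b.1 ord0 j), b.2).

Lemma box_leftE i t b : box (box_left i t b) = box b `&` [set x | x ord0 i <= t].
Proof.
apply/seteqP; split => [x /= h|x [/= h xt] j].
  split => [j|].
    have := h j; rewrite /= mxE; case: eqP => // ->.
    by rewrite le_min => /and3P[-> ->].
  by have := h i; rewrite /= mxE eqxx le_min => /and3P[].
rewrite /= mxE; case: eqP => [->|_]; last exact: h.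
by rewrite le_min xt andbT.
Qed.

Lemma box_rightE i t b : box (box_right i t b) = box b `&` ~` [set x | x ord0 i <= t].
Proof.
apply/seteqP; split => [x /= h|x [/= h /negP]].
  split => [j|].
    have := h j; rewrite /= mxE; case: eqP => // ->.
    by rewrite gt_max => /andP[/andP[-> _] ->].
  by have := h i; rewrite /= mxE eqxx gt_max => /andP[/andP[_ +] _];
    rewrite ltNge => /negP.
rewrite -ltNge => xt j.
rewrite /= mxE; case: eqP => [->|_]; last exact: h.
by rewrite gt_max xt andbT.
Qed.

Lemma box_volume_split i t b :
  box_volume (box_left i t b) + box_volume (box_right i t b) = box_volume b.
Proof.
have D (F : 'I_n.+1 -> R) : \prod_j F j = F i * \prod_(j | j != i) F j.
  by rewrite (bigD1 i).
rewrite /box_volume !D /=.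
under eq_bigr => j /negbTE ji do rewrite mxE ji.
under [in X in _ + X]eq_bigr => j /negbTE ji do rewrite mxE ji.
rewrite -mulrDl; congr (_ * _); rewrite !mxE eqxx.
move: (b.1 _ _) (b.2 _ _) => u v; rewrite !maxEle !minEle.
by case: (leP v t) => ?; case: (leP u t) => ?; repeat case: leP => ?; try lra.
Qed.

(** Cutting every box of a cover of X along the hyperplane yields covers of the two parts of X with
    the same total volume. *)
Lemma halfspace_caratheodory i t : mu.-caratheodory [set x | x ord0 i <= t].
Proof.
apply: le_caratheodory_measurable => X.
apply: le_ereal_inf_tmp => _ [c /= Xc <-].
have -> : (\sum_(k <oo) (box_volume (c k))%:E =
    \sum_(k <oo) (box_volume (box_left i t (c k)))%:E +
    \sum_(k <oo) (box_volume (box_right i t (c k)))%:E :> \bar R)%E.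
  rewrite -nneseriesD => [|k _ _|k _ _]; rewrite ?lee_fin ?box_volume_ge0//.
  by apply: eq_eseriesr => k _; rewrite -EFinD box_volume_split.
apply: leeD; apply: ereal_inf_lbound => /=.
  exists (box_left i t \o c) => //= x [/Xc[k _ ?] ?]; exists k => //=.
  by rewrite box_leftE.
exists (box_right i t \o c) => //= x [/Xc[k _ ?] ?]; exists k => //=.
by rewrite box_rightE.
Qed.

Local Notation VC := (caratheodory_type mu).

Lemma measurable_halfspace i t : measurable ([set x | x ord0 i <= t] : set VC).
Proof. exact: halfspace_caratheodory. Qed.

Lemma measurable_box b : measurable (box b : set VC).
Proof.
have -> : box b = \bigcap_(i in [set: 'I_n.+1])
    (~` [set x : VC | x ord0 i <= b.1 ord0 i] `&` [set x | x ord0 i <= b.2 ord0 i]).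
  apply/seteqP; split => [x h i _|x h i].
    by have /andP[h1 h2] := h i; split => //=; apply/negP; rewrite -ltNge.
  by have [/negP] := h i I; rewrite -ltNge => -> ->.
apply: fin_bigcap_measurable => // i _; apply: measurableI.
  by apply: measurableC; exact: measurable_halfspace.
exact: measurable_halfspace.
Qed.

(** An open set is the union of the half-open boxes with rational corners that it contains, and
    there are countably many of these. *)
Lemma open_measurable_rV A : open A -> measurable (A : set VC).
Proof.
move=> oA.
pose rb (q : 'rV[rat]_n.+1 * 'rV[rat]_n.+1) : V * V :=
  (map_mx ratr q.1, map_mx ratr q.2).
pose F q := if `[< box (rb q) `<=` A >] then box (rb q) else set0.
have -> : A = \bigcup_q F q.
  apply/seteqP; split => [x Ax|x [q _]]; last first.
    by rewrite /F; case: asboolP => // qA /qA.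
  have /nbhs_ballP[e /= e0 eA] := open_nbhs_nbhs (conj oA Ax).
  have h1 j : exists q : rat, x ord0 j - e / 2 < ratr q < x ord0 j.
    have /rat_in_itvoo[q] : x ord0 j - e / 2 < x ord0 j by lra.
    by rewrite in_itv/=; exists q.
  have h2 j : exists q : rat, x ord0 j < ratr q < x ord0 j + e / 2.
    have /rat_in_itvoo[q] : x ord0 j < x ord0 j + e / 2 by lra.
    by rewrite in_itv/=; exists q.
  have [f1 hf1] := choice h1; have [f2 hf2] := choice h2.
  pose q : 'rV[rat]_n.+1 * 'rV[rat]_n.+1 := (\row_j f1 j, \row_j f2 j).
  have qA : box (rb q) `<=` A.
    move=> y yq; apply: eA; split=> // i j; rewrite !ord1 /ball /=.
    have := yq j; rewrite /rb /q /= !mxE; have := hf1 j; have := hf2 j.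
    move=> /andP[? ?] /andP[? ?] /andP[? ?].
    rewrite ltr_norml; apply/andP; split; lra.
  exists q => //; rewrite /F asboolT// => j; rewrite /rb /q /= !mxE.
  by have /andP[_ ->] := hf1 j; have /andP[/ltW ->] := hf2 j.
apply: countable_bigcupT_measurable => [|q]; first exact: countableP.
by rewrite /F; case: ifP => _; [exact: measurable_box|exact: measurable0].
Qed.

Lemma borel_measurable_rV (B : set V) :
  measurable (B : set (borel_rV R n)) -> measurable (B : set VC).
Proof.
apply: smallest_sub; last by move=> C /= oC; exact: open_measurable_rV.
exact: sigma_algebra_measurable.
Qed.

Lemma measurable_fun_superlevel (f : V -> R) (s : R) :
  measurable_fun [set: borel_rV R n] f ->
  measurable ([set x | s < f x] : set VC).
Proof.
move=> mf; apply: borel_measurable_rV.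
rewrite -[X in measurable X]setTI (_ : [set x | _] = f @^-1` `]s, +oo[).
  by apply: mf => //; exact: measurableT.
by apply/seteqP; split => x /=; rewrite in_itv/= andbT.
Qed.

Lemma measurable_fun_EFin_rV (f : V -> R) :
  measurable_fun [set: borel_rV R n] f ->
  measurable_fun [set: VC] (EFin \o f).
Proof.
move=> mf; apply/measurable_EFinP => mT Y mY; rewrite setTI.
by apply: borel_measurable_rV; rewrite -[X in measurable X]setTI; exact: mf.
Qed.

End lebesgue_outer.

(** * Dilations, outer and inner regularity *)

Section regularity.
Context (R : realType) (n : nat).
Local Notation V := 'rV[R]_n.+1.
Implicit Types (b : V * V) (A X : set V) (i : 'I_n.+1) (t r v : R).
Local Notation mu := (@lebesgue_outer R n).
Local Notation VC := (caratheodory_type mu).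

Lemma prodrMl_const (m : nat) r (F : 'I_m -> R) :
  \prod_(i < m) (r * F i) = r ^+ m * \prod_(i < m) F i.
Proof. by rewrite big_split/= prodr_const card_ord. Qed.

Lemma dilateM r t A : dilate r (dilate t A) = dilate (r * t) A.
Proof.
apply/seteqP; split => [_ [_ [x Ax <-] <-]|_ [x Ax <-]].
  by exists x => //; rewrite scalerA.
by exists (t *: x); [exists x|rewrite scalerA].
Qed.

Lemma dilate1 A : dilate 1 A = A.
Proof.
apply/seteqP; split => [_ [x Ax <-]|x Ax]; first by rewrite scale1r.
by exists x => //; rewrite scale1r.
Qed.

Lemma lebesgue_outer_dilate_le r A : 0 < r ->
  (mu (dilate r A) <= (r ^+ n.+1)%:E * mu A)%E.
Proof.
move=> r0; have rn0 : 0 < r ^+ n.+1 by rewrite exprn_gt0.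
rewrite -lee_pdivrMl//; apply: le_ereal_inf_tmp => _ [c /= Ac <-].
rewrite lee_pdivrMl// -nneseriesZl; last by move=> k _; rewrite lee_fin box_volume_ge0.
apply: ereal_inf_lbound; exists (fun k => (r *: (c k).1, r *: (c k).2)) => /=.
  move=> _ [x /Ac[k _ xk] <-]; exists k => // i; rewrite /= !mxE.
  by rewrite ltr_pM2l// ler_pM2l//; exact: xk.
apply: eq_eseriesr => k _; rewrite -EFinM; congr (_%:E).
rewrite /box_volume -prodrMl_const.
by apply: eq_bigr => i _; rewrite !mxE -mulrBr maxr_pMr ?mulr0// ltW.
Qed.

Lemma lebesgue_outer_dilate r A : 0 < r ->
  (mu (dilate r A) = (r ^+ n.+1)%:E * mu A)%E.
Proof.
move=> r0; apply/eqP; rewrite eq_le lebesgue_outer_dilate_le//=.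
rewrite -lee_pdivlMl ?exprn_gt0// -exprVn -[in leLHS](dilate1 A).
by rewrite -(@mulVf _ r) ?gt_eqF// -dilateM lebesgue_outer_dilate_le ?invr_gt0.
Qed.

Definition open_box b : set V := [set x | forall i, b.1 ord0 i < x ord0 i < b.2 ord0 i].

Lemma open_open_box b : open (open_box b).
Proof.
rewrite openE => x xb; rewrite /interior.
apply: (@filter_forall _ _ (fun i => [set y : V | b.1 ord0 i < y ord0 i < b.2 ord0 i])
  (nbhs x)) => i.
have : nbhs (x ord0 i) `]b.1 ord0 i, b.2 ord0 i[%classic.
  by apply: open_nbhs_nbhs; split; [exact: interval_open|rewrite /= in_itv; exact: xb].
move=> /(@coord_continuous R 1 n.+1 ord0 i x) h.
by apply: (@filterS _ (nbhs x) _ _ _ _ h) => y /=; rewrite in_itv.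
Qed.

(* Scaling a half-open box by [c > 1] from its lower corner puts it in the
   interior of the scaled box, at the price of a factor [c ^+ n.+1]. *)
Lemma lebesgue_outer_regular A v : (mu A < v%:E)%E ->
  exists U, [/\ open U, A `<=` U & (mu U <= v%:E)%E].
Proof.
move=> /ereal_inf_lt[_ [c /= Ac <-]].
set S := (\sum_(k <oo) _)%E => Sv.
have S0 : (0 <= S)%E by apply: nneseries_ge0 => k _ _; rewrite lee_fin box_volume_ge0.
have Sf : S \is a fin_num by rewrite ge0_fin_numE// (lt_le_trans Sv)// leey.
have Sv' : fine S < v by rewrite -lte_fin fineK.
have v0 : 0 < v by rewrite (le_lt_trans _ Sv')// fine_ge0.
(* The sum S may be 0, so a positive S' between S and v is used; the scaling factor q with q^d =
   v/S' then exceeds 1 and keeps the enlarged cover below v. *)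
have [S' [S'0 SS' S'v]] : exists S', [/\ 0 < S', fine S < S' & S' < v].
  by exists ((fine S + v) / 2);
    rewrite midf_lt// midf_lt// divr_gt0// ltr_wpDl// fine_ge0.
pose q := (v / S') `^ n.+1%:R^-1.
have q1 : 1 < q.
  rewrite /q -[ltLHS](@exprK_powR R n 1 ler01).
  apply: gt0_ltr_powR; rewrite ?invr_gt0 ?nnegrE ?divr_ge0 ?(ltW v0) ?(ltW S'0)//.
  by rewrite expr1n ltr_pdivlMr// mul1r.
pose c' k : V * V := ((c k).1, (c k).1 + q *: ((c k).2 - (c k).1)).
have volc' k : box_volume (c' k) = q ^+ n.+1 * box_volume (c k).
  rewrite /box_volume -prodrMl_const.
  apply: eq_bigr => i _; rewrite !mxE addrAC subrr add0r.
  by rewrite maxr_pMr ?mulr0// ltW// (lt_trans ltr01).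
exists (\bigcup_k open_box (c' k)); split.
- by apply: bigcup_open => k _; exact: open_open_box.
- move=> x /Ac[k _ xk]; exists k => // i; rewrite /c' /= !mxE.
  have /andP[h1 h2] := xk i; rewrite h1 /=.
  apply: le_lt_trans h2 _; rewrite -ltrBlDl ltr_pMl//.
  by rewrite subr_gt0; have /andP[] := xk i => ? ?; apply: lt_le_trans h1 _.
- apply: (@le_trans _ _ (\sum_(k <oo) (box_volume (c' k))%:E)%E).
    apply: ereal_inf_lbound; exists c' => //= x [k _ xk]; exists k => // i.
    by have /andP[-> /ltW ->] := xk i.
  rewrite (eq_eseriesr (g := fun k => ((q ^+ n.+1)%:E * (box_volume (c k))%:E)%E));
    last first.
    by move=> k _; rewrite volc'.
  rewrite nneseriesZl; last by move=> k _; rewrite lee_fin box_volume_ge0.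
  rewrite -/S -(fineK Sf) -EFinM lee_fin /q powR_rootK ?divr_ge0 ?(ltW v0) ?(ltW S'0)//.
  by rewrite mulrAC ler_pdivrMr// ler_pM2l// ltW.
Qed.

Definition cube (m : R) : set V := [set x | forall i, x ord0 i \in `[- m, m]].

Lemma compact_cube m : compact (cube m).
Proof.
apply: (@rV_compact _ n.+1 (fun=> `[- m, m]%classic)) => i; exact: segment_compact.
Qed.

Lemma compact_measurable_rV C : compact C -> measurable (C : set VC).
Proof.
move=> cC; rewrite -(setCK C); apply: measurableC; apply: open_measurable_rV.
by apply: closed_openC; apply: compact_closed cC; exact: norm_hausdorff.
Qed.

Lemma cube_lty m : (mu (cube m) < +oo)%E.
Proof.
apply: (@le_lt_trans _ _ (mu (box (const_mx (- m - 1), const_mx m)))).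
  apply: le_lebesgue_outer => x xm i; rewrite /= !mxE.
  by have := xm i; rewrite in_itv/= => /andP[h ->]; rewrite andbT; lra.
by rewrite lebesgue_outer_box ltry.
Qed.

(** Truncation by a large cube Q keeps the measure above a. Then Q \ A lies in an open U of measure
    at most |Q| - a, and Q \ U is a compact part of A of measure at least a. *)
Lemma lebesgue_inner_regular A (a : R) : measurable (A : set VC) -> (a%:E < mu A)%E ->
  exists C, [/\ compact C, C `<=` A & (a%:E <= mu C)%E].
Proof.
move=> mA aA.
have mQ m : measurable (cube m : set VC) by apply: compact_measurable_rV;
  exact: compact_cube.
have [m am] : exists m : nat, (a%:E < mu (A `&` cube m%:R))%E.
  apply: contrapT => /forallNP h.
  have cvgA : mu (A `&` cube m%:R) @[m --> \oo] --> mu A.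
    have {2}-> : A = \bigcup_m (A `&` cube m%:R).
      rewrite -setI_bigcupr; apply/seteqP; split => [x Ax|x []//]; split => //.
      pose M := \sum_i `|x ord0 i|.
      have [m Mm] : exists m : nat, M <= m%:R.
        by exists (Num.truncn M).+1; rewrite ltW// truncnS_gt.
      exists m => // i; rewrite in_itv/= -ler_norml; apply: le_trans Mm.
      by rewrite /M (bigD1 i)//= lerDl sumr_ge0.
    apply: (@nondecreasing_cvg_mu _ VC R (@lebesgue_rV R n)).
    - by move=> m; apply: measurableI.
    - by apply: bigcup_measurable => m _; apply: measurableI.
    - move=> m1 m2 m12; apply/subsetPset; apply: setIS => x xm i.
      have := xm i; rewrite !in_itv/= -!ler_norml => /le_trans; apply.
      by rewrite ler_nat.
  have : (mu A <= a%:E)%E.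
    rewrite -(cvg_lim _ cvgA)//; apply: lime_le; first by apply/cvg_ex; exists (mu A).
    by apply: nearW => m; rewrite leNgt; apply/negP/h.
  by rewrite leNgt aA.
set Q := cube m%:R in am.
have Qf : mu Q \is a fin_num by rewrite ge0_fin_numE ?lebesgue_outer_ge0 ?cube_lty.
have AQf : mu (A `&` Q) \is a fin_num.
  rewrite ge0_fin_numE ?lebesgue_outer_ge0//.
  by apply: le_lt_trans (cube_lty m%:R); apply: le_lebesgue_outer; exact: subIsetr.
have QAE : mu (Q `\` A) = (mu Q - mu (A `&` Q))%E.
  rewrite (setIC A Q); apply: (@measureD _ VC R (@lebesgue_rV R n));
    [exact: mQ|exact: mA|exact: cube_lty].
have : (mu (Q `\` A) < (fine (mu Q) - a)%:E)%E.
  rewrite QAE EFinB fineK// -[X in (_ - X)%E]fineK// -[X in (X - _)%E]fineK//.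
  rewrite -(fineK Qf) -!EFinB lte_fin ltrD2l ltrN2 -lte_fin fineK//.
move=> /lebesgue_outer_regular[U [oU QAU Uv]].
exists (Q `\` U); split.
- apply: (@subclosed_compact _ _ Q); last exact: subDsetl.
    apply: closedI; last exact: open_closedC.
    by apply: compact_closed; [exact: norm_hausdorff|exact: compact_cube].
  exact: compact_cube.
- by move=> x [Qx Ux]; apply: contrapT => Ax; apply: Ux; exact: QAU.
- have mU : measurable (U : set VC) by exact: open_measurable_rV.
  have -> : mu (Q `\` U) = (mu Q - mu (Q `&` U))%E.
    by apply: (@measureD _ VC R (@lebesgue_rV R n));
      [exact: mQ|exact: mU|exact: cube_lty].
  have QUU : (mu (Q `&` U) <= (fine (mu Q) - a)%:E)%E.
    by apply: le_trans Uv; apply: le_lebesgue_outer; exact: subIsetr.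
  have QUf : mu (Q `&` U) \is a fin_num.
    by rewrite ge0_fin_numE ?lebesgue_outer_ge0// (le_lt_trans QUU)// ltry.
  move: QUU; rewrite -(fineK QUf) -[X in (_ <= X - _)%E](fineK Qf) -EFinB !lee_fin.
  by move=> ?; lra.
Qed.

End regularity.

(** * The Brunn-Minkowski inequality *)

Section brunn_minkowski_boxes.
Context (R : realType) (n : nat).
Local Notation V := 'rV[R]_n.+1.
Implicit Types (b c : V * V) (A S : set V) (i : 'I_n.+1) (r t v w : R)
  (s : seq (V * V)).
Local Notation mu := (@lebesgue_outer R n).
Local Notation d := (n.+1%:R : R).

(** The Brunn-Minkowski bound for an unweighted sum of sets; by [root_meanE] the weights of
    [root_mean] amount to dilating the two sets. *)
Definition bm v w : R := (v `^ d^-1 + w `^ d^-1) ^+ n.+1.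

Lemma bmC v w : bm v w = bm w v. Proof. by rewrite /bm addrC. Qed.

Lemma bm_homo r v w : 0 <= r -> 0 <= v -> 0 <= w ->
  bm (r * v) (r * w) = r * bm v w.
Proof.
by move=> r0 v0 w0; rewrite /bm !powRM// -mulrDr exprMn powR_rootK.
Qed.

Lemma le_bm v w v' w' : 0 <= v -> 0 <= w -> v <= v' -> w <= w' ->
  bm v w <= bm v' w'.
Proof.
move=> v0 w0 vv ww; rewrite lerXn2r ?nnegrE ?addr_ge0 ?powR_ge0//.
by rewrite lerD// ge0_le_powR ?invr_ge0.
Qed.

Lemma root_meanE lam v w : 0 < lam < 1 -> 0 <= v -> 0 <= w ->
  root_mean n lam v w = bm ((1 - lam) ^+ n.+1 * v) (lam ^+ n.+1 * w).
Proof.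
move=> /andP[l0 l1] v0 w0.
have l1' : 0 <= 1 - lam by rewrite subr_ge0 ltW.
by rewrite /bm !powRM ?exprn_ge0 ?(ltW l0)// !exprK_powR ?(ltW l0).
Qed.

Definition nondegenerate b := [forall i, b.1 ord0 i < b.2 ord0 i].

Definition separated b c :=
  [exists i, (b.2 ord0 i <= c.1 ord0 i) || (c.2 ord0 i <= b.1 ord0 i)].

Lemma box_volume_gt0 b : nondegenerate b -> 0 < box_volume b.
Proof.
move=> /forallP h; apply: prodr_gt0 => i _.
by rewrite lt_max subr_gt0 h orbT.
Qed.

Lemma box_volume_degenerate b : ~~ nondegenerate b -> box_volume b = 0.
Proof.
move=> /forallPn[i]; rewrite -leNgt => h.
by rewrite /box_volume (bigD1 i)//= max_l ?mul0r// subr_le0.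
Qed.

(* The arithmetic-geometric mean inequality for the ratios of the side lengths. *)
Lemma brunn_minkowski_box b c S : nondegenerate b -> nondegenerate c ->
  (forall x y, box b x -> box c y -> S (x + y)) ->
  ((bm (box_volume b) (box_volume c))%:E <= mu S)%E.
Proof.
move=> /forallP hb /forallP hc hS.
pose l i := b.2 ord0 i - b.1 ord0 i; pose m i := c.2 ord0 i - c.1 ord0 i.
have l0 i : 0 < l i by rewrite subr_gt0.
have m0 i : 0 < m i by rewrite subr_gt0.
have lm0 i : 0 < l i + m i by rewrite addr_gt0.
pose bc : V * V := (b.1 + c.1, b.2 + c.2).
have bcS : box bc `<=` S.
  move=> z zbc.
  (* The relative position of z along side i of the sum box; taking x and z - x at this same
     relative position in their own boxes decomposes z. *)
  pose q i := (z ord0 i - (b.1 ord0 i + c.1 ord0 i)) / (l i + m i).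
  have q01 i : 0 < q i <= 1.
    have := zbc i; rewrite /= !mxE => /andP[h1 h2].
    rewrite /q divr_gt0 ?subr_gt0//= ler_pdivrMr// mul1r /l /m; lra.
  pose x : V := \row_i (b.1 ord0 i + q i * l i).
  have xb : box b x.
    move=> i; rewrite mxE; have /andP[q0 q1] := q01 i.
    rewrite ltrDl mulr_gt0//= -lerBrDl -/(l i) ger_pMl//.
  have yc : box c (z - x).
    move=> i; rewrite !mxE; have /andP[q0 q1] := q01 i.
    have -> : z ord0 i - (b.1 ord0 i + q i * l i) = c.1 ord0 i + q i * m i.
      have : q i * (l i + m i) = z ord0 i - (b.1 ord0 i + c.1 ord0 i).
        by rewrite /q divfK// gt_eqF.
      rewrite mulrDr => ?; lra.
    by rewrite ltrDl mulr_gt0//= -lerBrDl -/(m i) ger_pMl.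
  by have := hS _ _ xb yc; rewrite addrC subrK.
apply: le_trans (le_lebesgue_outer bcS); rewrite lebesgue_outer_box lee_fin.
have volE : box_volume bc = \prod_i (l i + m i).
  apply: eq_bigr => i _; rewrite !mxE max_r; first by rewrite /l /m; ring.
  by have := lm0 i; rewrite /l /m => ?; lra.
have volb : box_volume b = \prod_i l i.
  by apply: eq_bigr => i _; rewrite max_r//; exact: ltW (l0 i).
have volc : box_volume c = \prod_i m i.
  by apply: eq_bigr => i _; rewrite max_r//; exact: ltW (m0 i).
have agm (F : 'I_n.+1 -> R) : (forall i, 0 <= F i) ->
    (\prod_i F i) `^ d^-1 <= (\sum_i F i) / d.
  move=> F0; have [+ _] := @leif_AGM R 'I_n.+1 predT F (fun i _ => F0 i).
  rewrite card_ord => h; have S0 : 0 <= (\sum_i F i) / d by rewrite divr_ge0// sumr_ge0.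
  rewrite -(exprK_powR n S0); apply: ge0_le_powR => //.
  by rewrite prodr_ge0.
set P := \prod_i (l i + m i) in volE.
have P0 : 0 < P by apply: prodr_gt0.
have -> : box_volume b = P * \prod_i (l i / (l i + m i)).
  by rewrite volb -big_split/=; apply: eq_bigr => i _; rewrite mulrC divfK// gt_eqF.
have -> : box_volume c = P * \prod_i (m i / (l i + m i)).
  by rewrite volc -big_split/=; apply: eq_bigr => i _; rewrite mulrC divfK// gt_eqF.
rewrite bm_homo ?(ltW P0)//; last 2 first.
- by apply: prodr_ge0 => i _; rewrite divr_ge0// ltW.
- by apply: prodr_ge0 => i _; rewrite divr_ge0// ltW.
rewrite volE ger_pMr// /bm exprn_ile1// ?addr_ge0 ?powR_ge0//.
apply: le_trans (lerD (agm _ _) (agm _ _)) _ => [i|i|].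
- by rewrite divr_ge0// ltW.
- by rewrite divr_ge0// ltW.
rewrite -mulrDl -big_split/=.
under eq_bigr => i _ do rewrite -mulrDl divff ?gt_eqF//.
by rewrite sumr_const card_ord divff.
Qed.

Definition volumes s : R := \sum_(b <- s) box_volume b.

(** Dropping degenerate pieces loses no volume and shortens the family whenever a box lies entirely
    on the other side, which drives the induction on the number of boxes. *)
Definition cut_left i t s := [seq b <- [seq box_left i t b | b <- s] | nondegenerate b].
Definition cut_right i t s :=
  [seq b <- [seq box_right i t b | b <- s] | nondegenerate b].

Definition box_family s := all nondegenerate s && pairwise separated s.

Lemma volumes_filter s : volumes [seq b <- s | nondegenerate b] = volumes s.
Proof.
rewrite /volumes big_filter [RHS](bigID nondegenerate)/= [X in _ = _ + X]big1 ?addr0//.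
by move=> b; exact: box_volume_degenerate.
Qed.

Lemma volumes_cut i t s : volumes (cut_left i t s) + volumes
  (cut_right i t s) = volumes s.
Proof.
rewrite !volumes_filter /volumes !big_map -big_split/=.
by apply: eq_bigr => b _; exact: box_volume_split.
Qed.

Lemma volumes_ge0 s : 0 <= volumes s.
Proof. by apply: sumr_ge0 => b _; exact: box_volume_ge0. Qed.

Lemma volumes_gt0 s : box_family s -> s != [::] -> 0 < volumes s.
Proof.
case: s => // b s /andP[/= /andP[nb _] _] _.
by rewrite /volumes big_cons ltr_pwDl ?box_volume_gt0// volumes_ge0.
Qed.

Lemma box_family_left i t s : box_family s -> box_family (cut_left i t s).
Proof.
move=> /andP[_ ps]; rewrite /box_family filter_all pairwise_filter//= pairwise_map.
apply: sub_pairwise ps => b c /existsP[j bc]; apply/existsP; exists j.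
rewrite /= !mxE; case: ifP => // /eqP ji; move: bc; rewrite ji.
by rewrite !ge_min => /orP[] h; apply/orP; [left|right]; apply/orP; left.
Qed.

Lemma box_family_right i t s : box_family s -> box_family (cut_right i t s).
Proof.
move=> /andP[_ ps]; rewrite /box_family filter_all pairwise_filter//= pairwise_map.
apply: sub_pairwise ps => b c /existsP[j bc]; apply/existsP; exists j.
rewrite /= !mxE; case: ifP => // /eqP ji; move: bc; rewrite ji.
by rewrite !le_max => /orP[] h; apply/orP; [left|right]; apply/orP; left.
Qed.

Lemma size_cut_left i t s : (size (cut_left i t s) <= size s)%N.
Proof. by rewrite size_filter (leq_trans (count_size _ _))// size_map. Qed.

Lemma size_cut_right i t s : (size (cut_right i t s) <= size s)%N.
Proof. by rewrite size_filter (leq_trans (count_size _ _))// size_map. Qed.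

Lemma mem_cut_left i t s b : b \in cut_left i t s ->
  exists2 c, c \in s & box b `<=` box c `&` [set x | x ord0 i <= t].
Proof.
rewrite mem_filter => /andP[_ /mapP[c cs ->]]; exists c => //.
by rewrite box_leftE.
Qed.

Lemma mem_cut_right i t s b : b \in cut_right i t s ->
  exists2 c, c \in s & box b `<=` box c `&` ~` [set x | x ord0 i <= t].
Proof.
rewrite mem_filter => /andP[_ /mapP[c cs ->]]; exists c => //.
by rewrite box_rightE.
Qed.

(** Cutting at the upper face of the lower of two separated boxes leaves one of them wholly on the
    left and the other wholly on the right, so each side keeps one box and loses one. *)
Lemma cut_exists s : box_family s -> (1 < size s)%N -> exists i t,
  [/\ (0 < size (cut_left i t s) < size s)%N & (0 < size (cut_right i t s) < size s)%N].
Proof.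
case: s => [|b [|c s]]// /andP[/= /and3P[nb nc _] /andP[/andP[bc _] _]] _.
have key i (u v : V * V) (s0 : seq (V * V)) : nondegenerate u -> nondegenerate v ->
    u.2 ord0 i <= v.1 ord0 i -> u \in s0 -> v \in s0 ->
    [/\ (0 < size (cut_left i (u.2 ord0 i) s0) < size s0)%N &
        (0 < size (cut_right i (u.2 ord0 i) s0) < size s0)%N].
  move=> nu nv uv us vs.
  have lu : box_left i (u.2 ord0 i) u = u.
    rewrite /box_left; case: u {nu us uv} => u1 u2 /=; congr (_, _); apply/rowP => j.
    by rewrite mxE; case: eqP => // ->; rewrite minxx.
  have rv : box_right i (u.2 ord0 i) v = v.
    rewrite /box_right; case: v {nv vs} uv => v1 v2 /= uv; congr (_, _);
      apply/rowP => j.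
    by rewrite mxE; case: eqP => // ->; rewrite max_l.
  have lv : ~~ nondegenerate (box_left i (u.2 ord0 i) v).
    by apply/forallPn; exists i; rewrite /= mxE eqxx -leNgt ge_min uv orbT.
  have ru : ~~ nondegenerate (box_right i (u.2 ord0 i) u).
    by apply/forallPn; exists i; rewrite /= mxE eqxx -leNgt le_max lexx orbT.
  have lt (f : V * V -> V * V) (z : V * V) : z \in s0 -> ~~ nondegenerate (f z) ->
      (size [seq x <- [seq f x | x <- s0] | nondegenerate x] < size s0)%N.
    move=> ws fw; rewrite size_filter -(size_map f s0).
    rewrite -(count_predC nondegenerate) -[ltnLHS]addn0 ltn_add2l -has_count.
    by apply/hasP; exists (f z) => //; exact: map_f.
  have gt (f : V * V -> V * V) (z : V * V) : z \in s0 -> nondegenerate (f z) ->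
      (0 < size [seq x <- [seq f x | x <- s0] | nondegenerate x])%N.
    move=> ws fw; rewrite size_filter -has_count.
    by apply/hasP; exists (f z) => //; exact: map_f.
  split; apply/andP; split.
  - by apply: (gt _ u); rewrite ?lu.
  - exact: (lt _ v).
  - by apply: (gt _ v); rewrite ?rv.
  - exact: (lt _ u).
case/existsP: bc => i /orP[] h; [exists i, (b.2 ord0 i)|exists i, (c.2 ord0 i)].
  by apply: (key i b c) => //; rewrite !inE eqxx ?orbT.
by apply: (key i c b) => //; rewrite !inE eqxx ?orbT.
Qed.

Lemma continuous_box_volume_left i b : continuous (fun t => box_volume
  (box_left i t b)).
Proof.
pose C := \prod_(j | j != i) Num.max 0 (b.2 ord0 j - b.1 ord0 j).
rewrite (_ : (fun t => _) = fun t => Num.max 0 (Num.min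
  (b.2 ord0 i) t - b.1 ord0 i) * C).
  move=> t; apply: cvgM; last exact: cvg_cst.
  apply: (@continuous_max R R (cst 0) (fun t => Num.min (b.2 ord0 i) t - b.1 ord0 i)).
    exact: cvg_cst.
  apply: cvgB; last exact: cvg_cst.
  apply: (@continuous_min R R (cst (b.2 ord0 i)) id) => //.
  exact: cvg_cst.
apply/funext => t; rewrite /box_volume (bigD1 i)//= mxE eqxx; congr (_ * _).
by apply: eq_bigr => j /negbTE ji; rewrite mxE ji.
Qed.

(** Intermediate value theorem for the volume to the left of the hyperplane, which is continuous in
    its position and goes from 0 at -M to the total at M, where M bounds the i-th coordinates of all
    corners. *)
Lemma cut_at_volume i s w : 0 <= w <= volumes s ->
  exists t, volumes (cut_left i t s) = w.
Proof.
move=> /andP[w0 ws]; pose F t := volumes [seq box_left i t b | b <- s].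
have FE t : volumes (cut_left i t s) = F t by rewrite volumes_filter.
have cF : continuous F.
  rewrite /F /volumes; elim: s {ws F FE} => [|b s ih].
    by under eq_fun do rewrite big_nil; exact: cst_continuous.
  under eq_fun do rewrite /= big_cons.
  by move=> t; apply: cvgD; [exact: continuous_box_volume_left|exact: ih].
pose M := \sum_(b <- s) (`|b.1 ord0 i| + `|b.2 ord0 i|).
have M0 : 0 <= M by apply: sumr_ge0.
have bM b : b \in s -> `|b.1 ord0 i| + `|b.2 ord0 i| <= M.
  by move=> bs; rewrite /M (big_rem b)//= lerDl sumr_ge0.
have Flo : F (- M) = 0.
  rewrite /F /volumes big_map big_seq big1// => b bs.
  apply: box_volume_degenerate; apply/forallPn; exists i.
  rewrite /= mxE eqxx -leNgt ge_min; apply/orP; right.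
  by have := bM _ bs; have := ler_norm (- b.1 ord0 i); rewrite normrN;
    have := normr_ge0 (b.2 ord0 i) => *; lra.
have Fhi : F M = volumes s.
  rewrite /F /volumes big_map big_seq [RHS]big_seq; apply: eq_bigr => b bs;
    congr box_volume.
  rewrite /box_left [RHS]surjective_pairing; congr (_, _); apply/rowP => j; rewrite mxE.
  case: eqP => // ->; rewrite min_l//.
  by have := bM _ bs; have := ler_norm (b.2 ord0 i);
    have := normr_ge0 (b.1 ord0 i) => *; lra.
have [|||t _ Ft] := @IVT R F (- M) M w.
- by rewrite (le_trans _ M0)// oppr_le0.
- exact: continuous_subspaceT.
- by rewrite Flo Fhi min_l ?max_r// ?w0 ?volumes_ge0.
by exists t; rewrite FE.
Qed.

(* Hadwiger and Ohmann: cut one family by a hyperplane separating two of its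
   boxes, and the other by a parallel hyperplane in the same proportion. *)
Lemma brunn_minkowski_boxes s s' S : box_family s -> box_family s' ->
  s != [::] -> s' != [::] ->
  (forall b c x y, b \in s -> c \in s' -> box b x -> box c y -> S (x + y)) ->
  ((bm (volumes s) (volumes s'))%:E <= mu S)%E.
Proof.
have [N] := ubnP (size s + size s')%N.
elim: N s s' S => // N ih s s' S; rewrite ltnS => sN fs fs' s0 s'0 hS.
have step u u' : (size u + size u' <= N)%N -> box_family u -> box_family u' ->
    u' != [::] -> (1 < size u)%N ->
    (forall b c x y, b \in u -> c \in u' -> box b x -> box c y -> S (x + y)) ->
    ((bm (volumes u) (volumes u'))%:E <= mu S)%E.
  move=> uN fu fu' u'0 su hu.
  have [i [t [/andP[l0 ls] /andP[r0 rs]]]] := cut_exists fu su.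
  have l0' : cut_left i t u != [::] by rewrite -size_eq0 -lt0n.
  have r0' : cut_right i t u != [::] by rewrite -size_eq0 -lt0n.
  have fl := box_family_left i t fu; have fr := box_family_right i t fu.
  have vl := volumes_gt0 fl l0'; have vr := volumes_gt0 fr r0'.
  have vlr := volumes_cut i t u.
  have vu : 0 < volumes u by rewrite -vlr addr_gt0.
  have vu' : 0 < volumes u'.
    by apply: volumes_gt0.
  pose th := volumes (cut_left i t u) / volumes u.
  have th0 : 0 < th by rewrite divr_gt0.
  have th1 : th < 1 by rewrite ltr_pdivrMr// mul1r -vlr ltrDl.
  have [|t' vl'] := @cut_at_volume i u' (th * volumes u').
    by rewrite mulr_ge0 ?(ltW th0) ?volumes_ge0//= ger_pMl// ltW.
  have vlE : volumes (cut_left i t u) = th * volumes u by rewrite /th divfK// gt_eqF.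
  have vrE : volumes (cut_right i t u) = (1 - th) * volumes u.
    by rewrite mulrBl mul1r -vlE -vlr addrC addKr.
  have vr' : volumes (cut_right i t' u') = (1 - th) * volumes u'.
    by rewrite mulrBl mul1r -vl' -(volumes_cut i t' u') addrC addKr.
  have ne (w : seq (V * V)) : 0 < volumes w -> w != [::].
    by case: w => //; rewrite /volumes big_nil ltxx.
  have l'0 : cut_left i t' u' != [::] by apply: ne; rewrite vl' mulr_gt0.
  have r'0 : cut_right i t' u' != [::] by apply: ne; rewrite vr' mulr_gt0// subr_gt0.
  (* Left pieces sum into the part of S up to t + t' and right pieces into the rest, for an
     arbitrary S. As both families are cut in the proportion th, [bm] splits exactly, by
     homogeneity, into the shares th and 1 - th. *)
  rewrite (halfspace_caratheodory i (t + t') S).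
  have -> : bm (volumes u) (volumes u') =
      bm (volumes (cut_left i t u)) (volumes (cut_left i t' u')) +
      bm (volumes (cut_right i t u)) (volumes (cut_right i t' u')).
    rewrite vlE vl' vrE vr' !bm_homo ?(ltW vu) ?(ltW vu') ?(ltW th0) ?subr_ge0
      ?(ltW th1)//.
    by rewrite -mulrDl addrC subrK mul1r.
  rewrite EFinD; apply: leeD; apply: ih => //.
  - by apply: leq_trans uN; rewrite -addSn leq_add// size_cut_left.
  - exact: box_family_left.
  - move=> b c x y /mem_cut_left[b' b'u bb'] /mem_cut_left[c' c'u cc'] bx cy.
    have [? xt] := bb' _ bx; have [? yt] := cc' _ cy; split; first exact: (hu b' c').
    by rewrite /= !mxE lerD.
  - by apply: leq_trans uN; rewrite -addSn leq_add// size_cut_right.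
  - exact: box_family_right.
  - move=> b c x y /mem_cut_right[b' b'u bb'] /mem_cut_right[c' c'u cc'] bx cy.
    have [? xt] := bb' _ bx; have [? yt] := cc' _ cy; split; first exact: (hu b' c').
    move: xt yt => /negP + /negP; rewrite -!ltNge => xt yt.
    by apply/negP; rewrite -ltNge /= !mxE ltrD.
have [s1|s1] := ltnP 1 (size s); first exact: step.
have [s'1|s'1] := ltnP 1 (size s').
  rewrite bmC; apply: step => //; first by rewrite addnC.
  by move=> b c x y bs cs bx cy; rewrite addrC; exact: (hS c b).
case: s fs s0 hS {step sN} s1 => [|b [|//]]// fs _ hS _.
case: s' fs' s'0 hS s'1 => [|c [|//]]// fs' _ hS _.
rewrite /volumes !big_seq1; apply: brunn_minkowski_box.
- by case/andP: fs => /andP[].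
- by case/andP: fs' => /andP[].
- by move=> x y; apply: hS; rewrite inE.
Qed.

End brunn_minkowski_boxes.

(** * From boxes to compact and measurable sets *)

Section brunn_minkowski.
Context (R : realType) (n : nat).
Local Notation V := 'rV[R]_n.+1.
Implicit Types (A B C D S U : set V) (i : 'I_n.+1) (a b e : R).
Local Notation mu := (@lebesgue_outer R n).
Local Notation VC := (caratheodory_type mu).

Lemma compact_coord_bounded C : compact C -> exists2 M : R, 0 < M &
  forall x i, C x -> `|x ord0 i| < M.
Proof.
move=> /compact_bounded[M [_ hM]].
exists (`|M| + 2); first by rewrite ltr_wpDl.
move=> x i Cx; have {}hM : `|x| <= `|M| + 1.
  by apply: hM => //; rewrite (le_lt_trans (ler_norm M))// ltrDl.
have : ball (0 : V) (`|M| + 2) x.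
  by rewrite mx_norm_ball /ball_ /= sub0r normrN; lra.
by move=> [_ /(_ ord0 i)]; rewrite mxE /ball /= sub0r normrN.
Qed.

Lemma ex_nat_ceil (K : nat) (y : R) : 0 < y <= K%:R ->
  exists2 k : 'I_K, k%:R < y & y <= k.+1%:R.
Proof.
elim: K => [|K ih] /andP[y0 yK]; first by rewrite leNgt y0 in yK.
have [yK'|Ky] := leP y K%:R; last by exists ord_max.
by have [|k ? ?] := ih; [rewrite y0|exists (widen_ord (leqnSn K) k)].
Qed.

(** The family consists of the cells meeting C in a half-open grid of mesh at most e, so the cells
    are separated and stay close to C. *)
Lemma grid_cover C e : compact C -> 0 < e -> exists s : seq (V * V),
  [/\ box_family s, forall x, C x -> exists2 p, p \in s & box p x &
      forall p x, p \in s -> box p x ->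
        exists2 c, C c & forall i, `|x ord0 i - c ord0 i| < e].
Proof.
move=> /compact_coord_bounded[M M0 CM] e0.
pose K := (Num.truncn (2 * M / e)).+1.
have K0 : 0 < K%:R :> R by [].
pose dl := 2 * M / K%:R.
have dl0 : 0 < dl by rewrite divr_gt0// mulr_gt0.
have dle : dl <= e.
  rewrite /dl ler_pdivrMr// -ler_pdivrMl// mulrC ltW// /K truncnS_gt//.
pose g (k : nat) : R := - M + dl * k%:R.
pose gb (k : {ffun 'I_n.+1 -> 'I_K}) : V * V :=
  (\row_i g (k i), \row_i g (k i).+1).
have gS k : g k.+1 = g k + dl by rewrite /g -natr1; ring.
pose P k := `[< exists2 c, C c & box (gb k) c >].
exists [seq gb k | k <- enum P]; split.
- apply/andP; split.
    apply/allP => _ /mapP[k _ ->]; apply/forallP => i; rewrite !mxE gS.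
    by rewrite ltrDl.
  have := enum_uniq P; rewrite uniq_pairwise pairwise_map.
  apply: sub_pairwise => k k' /= kk'.
  have /existsP[i] : [exists i, k i != k' i].
    rewrite -negb_forall; apply: contra kk' => /forallP h.
    by apply/eqP/ffunP => i; apply/eqP.
  have gle (l l' : nat) : (l <= l')%N -> g l <= g l'.
    by move=> ll; rewrite /g lerD2l ler_pM2l// ler_nat.
  rewrite neq_ltn => /orP[] lt; apply/existsP; exists i; rewrite !mxE; apply/orP.
    by left; exact: gle.
  by right; exact: gle.
- move=> x Cx.
  have h i : exists k : 'I_K, g k < x ord0 i <= g k.+1.
    have [|k k1 k2] := @ex_nat_ceil K ((x ord0 i + M) / dl).
      have := CM x i Cx; rewrite ltr_norml => /andP[h1 h2].
      rewrite divr_gt0//=; last by lra.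
      rewrite ler_pdivrMr// /dl mulrC divfK ?gt_eqF//; lra.
    exists k; move: k1 k2; rewrite ltr_pdivlMr// ler_pdivrMr// /g => h1 h2.
    by apply/andP; split; rewrite mulrC; lra.
  have [k hk] := choice h.
  have xk : box (gb (finfun k)) x by move=> i; rewrite !mxE !ffunE.
  exists (gb (finfun k)) => //; apply: map_f; rewrite mem_enum.
  by apply/asboolP; exists x.
- move=> _ x /mapP[k + ->]; rewrite mem_enum => /asboolP[c Cc kc] kx.
  exists c => // i; have := kc i; have := kx i; rewrite !mxE gS.
  move=> /andP[? ?] /andP[? ?]; apply: lt_le_trans dle.
  by rewrite ltr_norml; apply/andP; split; lra.
Qed.

Lemma compact_open_margin S U : compact S -> open U -> S `<=` U ->
  exists2 e : R, 0 < e & forall x y : V, S x ->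
    (forall i, `|y ord0 i - x ord0 i| < e) -> U y.
Proof.
move=> /compact_near_coveringP cS oU SU.
pose P (e : R) (x : V) := forall y : V, (forall i, `|y ord0 i - x ord0 i| < e) -> U y.
have /cS : forall x, S x -> \forall x' \near x & e \near 0^'+, P e x'.
  move=> x Sx; have /nbhs_ballP[r /= r0 rU] := open_nbhs_nbhs (conj oU (SU _ Sx)).
  exists (ball x (r / 2), `]0, r / 2[%classic) => /=.
    split; first by apply: nbhsx_ballx; rewrite divr_gt0.
    near=> e; rewrite /= in_itv/=; apply/andP; split; near: e.
      exact: nbhs_right_gt.
    by apply: nbhs_right_lt; rewrite divr_gt0.
  move=> [x' e] /= [[_ xx'] +] y ye; rewrite in_itv/= => /andP[e0 er].
  apply: rU; split => // k i; rewrite (ord1 k) /ball /=.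
  have := xx' ord0 i; have := ye i; rewrite /ball /= => h1 h2.
  have -> : x ord0 i - y ord0 i = (x ord0 i - x' ord0 i) -
    (y ord0 i - x' ord0 i) by ring.
  by apply: le_lt_trans (ler_normB _ _) _; lra.
move=> h; have [e []] : exists e : R, 0 < e /\ S `<=` P e.
  near (0 : R)^'+ => e; exists e; split => //.
  by near: e; exact: h.
by move=> e0 SP; exists e => // x y Sx; exact: SP.
Unshelve. all: by end_near. Qed.

(** If the bound failed, an open U around C + D would violate it too. Fine grid covers of C and D
    have sums inside U and volumes at least a and b, against the inequality for box families. *)
Lemma brunn_minkowski_compact C D a b : compact C -> compact D ->
  C !=set0 -> D !=set0 -> 0 <= a -> 0 <= b ->
  (a%:E <= mu C)%E -> (b%:E <= mu D)%E ->
  ((bm n a b)%:E <= mu [set (x + y)%R | x in C & y in D])%E.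
Proof.
move=> cC cD [c Cc] [d' Dd] a0 b0 aC bD; set S := (X in mu X).
have cS : compact S.
  have -> : S = (fun z : V * V => z.1 + z.2) @` (C `*` D).
    apply/seteqP; split => [_ [x Cx [y Dy <-]]|_ [[x y] [Cx Dy] <-]].
      by exists (x, y).
    by exists x => //; exists y.
  apply: continuous_compact; last exact: compact_setX.
  by apply: continuous_subspaceT => z; exact: add_continuous.
rewrite leNgt; apply/negP => lt.
have Sf : mu S \is a fin_num.
  by rewrite ge0_fin_numE ?lebesgue_outer_ge0// (lt_trans lt)// ltry.
have lt' : fine (mu S) < bm n a b by rewrite -lte_fin fineK.
have [m1 m2] := midf_lt lt'; set v := (_ / 2) in m1 m2.
have /lebesgue_outer_regular[U [oU SU Uv]] : (mu S < v%:E)%E.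
  by rewrite -(fineK Sf) lte_fin.
have [e e0 eU] := compact_open_margin cS oU SU.
have e20 : 0 < e / 2 by rewrite divr_gt0.
have [s [fs Cs sC]] := grid_cover cC e20.
have [s' [fs' Ds' s'D]] := grid_cover cD e20.
have s0 : s != [::] by have [x + _] := Cs _ Cc; case: (s).
have s'0 : s' != [::] by have [x + _] := Ds' _ Dd; case: (s').
have : ((bm n (volumes s) (volumes s'))%:E <= mu U)%E.
  apply: brunn_minkowski_boxes => // p q x y ps qs px qy.
  have [x' Cx' xx'] := sC _ _ ps px; have [y' Dy' yy'] := s'D _ _ qs qy.
  apply: (eU (x' + y')) => [|i]; first by exists x' => //; exists y'.
  rewrite !mxE opprD addrACA; apply: le_lt_trans (ler_normD _ _) _.
  by have := xx' i; have := yy' i; lra.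
have as_ : a <= volumes s by rewrite -lee_fin (le_trans aC)// lebesgue_outer_boxes.
have bs' : b <= volumes s' by rewrite -lee_fin (le_trans bD)// lebesgue_outer_boxes.
move=> /le_trans/(_ Uv); rewrite lee_fin => h.
have := le_lt_trans (le_trans (le_bm n a0 b0 as_ bs') h) m2.
by rewrite ltxx.
Qed.

Lemma continuous_scale_rV (r : R) : continuous (fun x : V => r *: x).
Proof. exact: scaler_continuous. Qed.

Lemma compact_dilate (r : R) C : compact C -> compact (dilate r C).
Proof.
move=> cC; apply: continuous_compact => //.
by apply: continuous_subspaceT; exact: continuous_scale_rV.
Qed.

(** The full Minkowski combination is not known to be measurable, so a compact part of it is
    returned; the strict bounds on [mu A] and [mu B] leave room for compact sets inside A and B. *)
Lemma brunn_minkowski (lam : R) A B a b : 0 < lam < 1 ->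
  measurable (A : set VC) -> measurable (B : set VC) ->
  0 < a -> 0 < b -> (a%:E < mu A)%E -> (b%:E < mu B)%E ->
  exists S, [/\ measurable (S : set VC),
    forall z, S z -> exists x y, [/\ A x, B y & z = (1 - lam) *: x + lam *: y] &
    ((root_mean n lam a b)%:E <= mu S)%E].
Proof.
move=> ll mA mB a0 b0 aA bB; have /andP[l0 l1] := ll.
have l1' : 0 < 1 - lam by rewrite subr_gt0.
have [C [cC CA aC]] := lebesgue_inner_regular mA aA.
have [D [cD DB bD]] := lebesgue_inner_regular mB bB.
have ne E (x : R) : 0 < x -> (x%:E <= mu E)%E -> E !=set0.
  move=> x0 xE; apply/set0P/eqP => E0; move: xE.
  by rewrite E0 lebesgue_outer0 lee_fin leNgt x0.
have [c Cc] := ne _ _ a0 aC; have [d' Dd] := ne _ _ b0 bD.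
exists [set x + y | x in dilate (1 - lam) C & y in dilate lam D]; split.
- apply: compact_measurable_rV.
  rewrite (_ : [set _ | _ in _ & _ in _] =
    (fun z : V * V => z.1 + z.2) @` (dilate (1 - lam) C `*` dilate lam D)).
    apply: continuous_compact; last by apply: compact_setX; exact: compact_dilate.
    by apply: continuous_subspaceT => z; exact: add_continuous.
  apply/seteqP; split => [_ [x Cx [y Dy <-]]|_ [[x y] [Cx Dy] <-]].
    by exists (x, y).
  by exists x => //; exists y.
- by move=> _ [_ [x Cx <-] [_ [y Dy <-] <-]]; exists x, y; split;
  [exact: CA|exact: DB|].
- rewrite root_meanE ?(ltW a0) ?(ltW b0)//; apply: brunn_minkowski_compact.
  + exact: compact_dilate.
  + exact: compact_dilate.
  + by exists ((1 - lam) *: c), c.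
  + by exists (lam *: d'), d'.
  + by rewrite mulr_ge0 ?exprn_ge0 ?ltW.
  + by rewrite mulr_ge0 ?exprn_ge0 ?ltW.
  + by rewrite lebesgue_outer_dilate// EFinM lee_wpmul2l// lee_fin exprn_ge0// ltW.
  + by rewrite lebesgue_outer_dilate// EFinM lee_wpmul2l// lee_fin exprn_ge0// ltW.
Qed.

End brunn_minkowski.

(** * Layer sums *)

Section layer_sums.
Context (R : realType).
Implicit Types (dl v : R) (y : \bar R) (J : nat).
Local Open Scope ereal_scope.

(** Layer-cake formula discretised with mesh dl and cut off at height dl J. Levels are tested at the
    upper ends of the layers, so the sum stays below y. *)
Definition layer_sum dl J y : R :=
  (\sum_(j < J) dl * ((dl * j.+1%:R)%:E < y)%E%:R)%R.

Lemma layer_sum_ge0 dl J y : (0 <= dl)%R -> (0 <= layer_sum dl J y)%R.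
Proof. by move=> dl0; apply: sumr_ge0 => j _; rewrite mulr_ge0. Qed.

Lemma layer_sum_leJ dl J y : (0 <= dl)%R -> (layer_sum dl J y <= dl * J%:R)%R.
Proof.
move=> dl0; rewrite mulr_natr -[X in (_ <= _ *+ X)%R]card_ord -sumr_const.
by apply: ler_sum => j _; case: (_ < _); rewrite ?mulr1// mulr0.
Qed.

Lemma layer_sum_le dl J y : (0 <= dl)%R -> 0 <= y -> (layer_sum dl J y)%:E <= y.
Proof.
move=> dl0 y0; elim: J => [|J ih]; first by rewrite /layer_sum big_ord0.
have [lt|ge] := boolP ((dl * J.+1%:R)%:E < y).
  by apply: le_trans (ltW lt); rewrite lee_fin layer_sum_leJ.
by rewrite /layer_sum big_ord_recr/= (negbTE ge) mulr0 addr0.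
Qed.

Lemma layer_sum_ge dl J y v : (0 <= dl)%R -> v%:E <= y ->
  (Num.min (v - dl) (dl * J%:R) <= layer_sum dl J y)%R.
Proof.
move=> dl0 vy; elim: J => [|J ih].
  by rewrite /layer_sum big_ord0 mulr0 ge_min lexx orbT.
rewrite /layer_sum big_ord_recr/= -/(layer_sum dl J y).
have [lt|] := boolP ((dl * J.+1%:R)%:E < y).
  suff -> : layer_sum dl J y = (dl * J%:R)%R.
    by rewrite mulr1 ge_min; apply/orP; right; rewrite -natr1 mulrDr mulr1.
  rewrite /layer_sum mulr_natr -[X in (_ = _ *+ X)%R]card_ord -sumr_const.
  apply: eq_bigr => j _; rewrite (le_lt_trans _ lt) ?mulr1//.
  by rewrite lee_fin ler_wpM2l// ler_nat ltnS ltnW.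
rewrite -leNgt => ge; rewrite mulr0 addr0.
have := le_trans vy ge; rewrite lee_fin -natr1 mulrDr mulr1 => h.
by apply: le_trans ih; rewrite le_min !ge_min lexx/=; apply/orP; left; lra.
Qed.

Lemma ge_limn_einf (u : (\bar R)^nat) y : (\forall k \near \oo, y <= u k) ->
  y <= limn_einf u.
Proof.
move=> [N _ h]; rewrite limn_einf_lim; apply: lime_ge; first exact: is_cvg_einfs.
exists N => // k /= Nk; apply: le_ereal_inf_tmp => _ [m /= km <-].
by apply: h; rewrite /= (leq_trans Nk).
Qed.

Lemma le_limn_einf (u : (\bar R)^nat) y : (forall k, u k <= y) -> limn_einf u <= y.
Proof.
move=> h; rewrite limn_einf_lim; apply: lime_le; first exact: is_cvg_einfs.
apply: nearW => k; apply: le_trans (h k); apply: ereal_inf_lbound.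
by exists k => /=.
Qed.

Context d (T : measurableType d) (mu : {measure set T -> \bar R}).

(** Only the sets [L j] inside the superlevel sets are measurable, not [h]; this serves for the
    sup-convolution of the original functions. *)
Lemma layer_sum_le_integral (h : T -> \bar R) (L : nat -> set T) dl J :
  (0 <= dl)%R -> (forall x, 0 <= h x) ->
  (forall j, measurable (L j)) ->
  (forall j x, L j x -> (dl * j.+1%:R)%:E < h x) ->
  \sum_(j < J) dl%:E * mu (L j) <= \int[mu]_x h x.
Proof.
move=> dl0 h0 mL hL.
have mI j : measurable_fun setT (fun x => (\1_(L j) x)%:E : \bar R).
  by apply/measurable_EFinP; exact: measurable_indic.
apply: (@le_trans _ _ (\int[mu]_x \sum_(j < J) dl%:E * (\1_(L j) x)%:E)).
  rewrite ge0_integral_sum//; last 2 first.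
  - by move=> j; apply: measurable_funeM; exact: mI.
  - by move=> j x _; rewrite mule_ge0// lee_fin.
  apply: lee_sum => j _; rewrite ge0_integralZl_EFin//.
  by rewrite integral_indic// setIT.
apply: ge0_le_integral_lower => x _.
  by apply: sume_ge0 => j _; rewrite mule_ge0// lee_fin.
apply: le_trans (layer_sum_le J dl0 (h0 x)).
rewrite sumEFin lee_fin; apply: ler_sum => j _; rewrite ler_wpM2l// indicE.
by case: (boolP (x \in L j)) => // /set_mem/hL ->.
Qed.

(** With mesh 1/(N+1) and height N+1, the layer sums have lower limit at least k. The meshes are not
    nested, so the sums need not increase with N, and Fatou's lemma is used rather than monotone
    convergence. *)
Lemma lt_integral_layer_sum (k : T -> \bar R) v :
  measurable_fun setT k -> (forall x, 0 <= k x) -> (0 <= v)%R ->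
  v%:E < \int[mu]_x k x ->
  exists dl J, (0 < dl)%R /\
    v%:E < \sum_(j < J) dl%:E * mu [set x | (dl * j.+1%:R)%:E < k x].
Proof.
move=> mk k0 v0 vk; apply: contrapT => no.
pose dl (N : nat) : R := (N.+1%:R^-1)%R; pose J N := (N.+1 * N.+1)%N.
have dl0 N : (0 < dl N)%R by rewrite /dl invr_gt0.
have dlJ N : (dl N * (J N)%:R = N.+1%:R)%R by rewrite /dl /J natrM mulKf// pnatr_eq0.
pose L N (j : nat) := [set x | (dl N * j.+1%:R)%:E < k x].
have mL N j : measurable (L N j).
  by rewrite -[L N j]setTI; exact: emeasurable_fun_o_infty.
pose g N x := (layer_sum (dl N) (J N) (k x))%:E.
have gE N x : g N x = \sum_(j < J N) (dl N)%:E * (\1_(L N j) x)%:E.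
  rewrite /g /layer_sum -sumEFin; apply: eq_bigr => j _; rewrite EFinM indicE.
  congr (_ * _%:R%:E); congr nat_of_bool; apply/idP/idP => [?|/set_mem//].
  exact: mem_set.
have mI N j : measurable_fun setT (fun x => (\1_(L N j) x)%:E : \bar R).
  by apply/measurable_EFinP; exact: measurable_indic.
have mg N : measurable_fun setT (g N).
  rewrite (_ : g N = fun x => \sum_(j < J N) (dl N)%:E * (\1_(L N j) x)%:E); last first.
    by apply/funext => x; rewrite gE.
  by apply: emeasurable_sum => j; apply: measurable_funeM; exact: mI.
have g0 N x : setT x -> 0 <= g N x by rewrite lee_fin layer_sum_ge0// ltW.
have intg N : \int[mu]_x g N x = \sum_(j < J N) (dl N)%:E * mu (L N j).
  under eq_integral do rewrite gE.
  rewrite ge0_integral_sum//; last 2 first.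
  - by move=> j; apply: measurable_funeM; exact: mI.
  - by move=> j x _; rewrite mule_ge0 ?lee_fin ?(ltW (dl0 N)).
  apply: eq_bigr => j _; rewrite ge0_integralZl_EFin ?(ltW (dl0 N))//.
  by rewrite integral_indic// setIT.
have intgv N : \int[mu]_x g N x <= v%:E.
  rewrite intg leNgt; apply/negP => h; apply: no; exists (dl N), (J N); split => //.
suff : \int[mu]_x k x <= v%:E by rewrite leNgt vk.
apply: le_trans (le_limn_einf intgv).
apply: le_trans (fatou mu measurableT mg g0).
apply: ge0_le_integral_lower => // x _.
rewrite leNgt; apply/negP => lt.
have lg0 : 0 <= limn_einf (g ^~ x) by apply: ge_limn_einf; apply: nearW => N; exact: g0.
have lgf : limn_einf (g ^~ x) \is a fin_num
  by rewrite ge0_fin_numE// (lt_le_trans lt)// leey.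
move: lt lg0; rewrite -(fineK lgf); set w := fine _ => lt; rewrite lee_fin => w0.
have [w' ww' w'k] : exists2 w', (w < w')%R & w'%:E <= k x.
  case: (k x) lt (k0 x) => [r| |]//; first by rewrite lte_fin => ? _; exists r.
  by move=> _ _; exists (w + 1)%R; rewrite ?ltrDl// leey.
pose w1 := ((w + w') / 2)%R; have [ww1 w1w'] := midf_lt ww'.
suff : w1%:E <= limn_einf (g ^~ x) by rewrite -(fineK lgf) lee_fin leNgt ww1.
apply: ge_limn_einf; near=> N; rewrite lee_fin.
apply: le_trans (layer_sum_ge _ (ltW (dl0 N)) w'k); rewrite dlJ le_min; apply/andP;
  split.
  rewrite lerBrDl -lerBrDr; near: N.
  have : (0 < w' - w1)%R by rewrite subr_gt0.
  move=> h; have := near_infty_natSinv_lt (PosNum h).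
  by apply: filterS => N /ltW.
near: N; exists (Num.truncn w1).+1 => // N /= h.
by rewrite ltW// (lt_le_trans (truncnS_gt _))// ler_nat (leq_trans h).
Unshelve. all: by end_near. Qed.

End layer_sums.

(** * Rearrangements *)

Section rearrangement_lemmas.
Context (R : realType) (n : nat).
Local Notation V := 'rV[R]_n.+1.
Local Notation mu := (@lebesgue_outer R n).
Local Notation VC := (caratheodory_type mu).
Variable K : set V.
Hypothesis bodyK : rearrangement_body K.
Implicit Types (A : set V) (f : V -> R) (x y z : V) (r s t a b u v : R).

Let k : R := fine (mu K).

Let openK : open K. Proof. by case: bodyK. Qed.

Lemma body_volume_fin : mu K = k%:E.
Proof.
case: bodyK => _ _ _ /andP[K0 Ky] _; rewrite /k fineK// ge0_fin_numE//.
exact: lebesgue_outer_ge0.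
Qed.

Lemma body_volume_gt0 : 0 < k.
Proof.
by have [_ _ _ /andP[+ _] _] := bodyK; rewrite /lebesgue_rV body_volume_fin lte_fin.
Qed.

Lemma dilateE r A x : r != 0 -> dilate r A x <-> A (r^-1 *: x).
Proof.
move=> r0; split => [[y Ay <-]|Ax]; first by rewrite scalerA mulVf// scale1r.
by exists (r^-1 *: x) => //; rewrite scalerA mulfV// scale1r.
Qed.

Lemma body_convex x y t : 0 <= t <= 1 -> K x -> K y -> K (t *: x + (1 - t) *: y).
Proof.
move=> /andP[t0 t1] Kx Ky; have [_ _ + _ _] := bodyK.
by move=> /(_ x y (Itv01 t0 t1)); rewrite !inE; apply.
Qed.

Lemma body_dilate_sum r s x y : 0 < r -> 0 < s -> K x -> K y ->
  dilate (r + s) K (r *: x + s *: y).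
Proof.
move=> r0 s0 Kx Ky; have rs0 : 0 < r + s by rewrite addr_gt0.
exists ((r / (r + s)) *: x + (1 - r / (r + s)) *: y).
  apply: body_convex => //; rewrite divr_ge0 ?(ltW r0) ?(ltW rs0)//=.
  by rewrite ler_pdivrMr// mul1r lerDl ltW.
have -> : 1 - r / (r + s) = s / (r + s).
  by apply: (mulIf (lt0r_neq0 rs0)); rewrite mulrBl mul1r !divfK ?gt_eqF// addrC addKr.
by rewrite scalerDr !scalerA !(mulrC (r + s)) !divfK// gt_eqF.
Qed.

(** The origin lies only in the closure of K, so it cannot itself enter a convex combination. For y
    in K near 0 and w = (1 - t)/t, openness puts x - w y in K, and t (x - w y) + (1 - t) y = t x. *)
Lemma body_star x t : 0 < t -> t <= 1 -> K x -> K (t *: x).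
Proof.
move=> t0 t1 Kx; pose w := (1 - t) / t.
have w0 : 0 <= w by rewrite divr_ge0 ?subr_ge0// ltW.
have /nbhs_ballP[e /= e0 eK] := open_nbhs_nbhs (conj openK Kx).
have [_ _ _ _ clK] := bodyK.
have w10 : 0 < w + 1 by rewrite ltr_wpDl.
have [|y [Ky y0]] := clK (ball (0 : V) (e / (w + 1))).
  by apply: nbhsx_ballx; rewrite divr_gt0.
have Kx' : K (x - w *: y).
  apply: eK; split => // i j; rewrite (ord1 i) !mxE /ball /=.
  have -> : x ord0 j - (x ord0 j - w * y ord0 j) = w * y ord0 j by ring.
  rewrite normrM (ger0_norm w0).
  have [_ /(_ ord0 j)] := y0; rewrite mxE /ball /= sub0r normrN ltr_pdivlMr// => h.
  apply: le_lt_trans h; rewrite mulrC ler_wpM2l//; lra.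
have : K (t *: (x - w *: y) + (1 - t) *: y).
  by apply: body_convex => //; rewrite (ltW t0) t1.
rewrite scalerBr scalerA /w mulrC divfK ?gt_eqF// subrK//.
Qed.

Lemma dilate_body_homo r s : 0 < r -> r <= s -> dilate r K `<=` dilate s K.
Proof.
move=> r0 rs _ [x Kx <-]; have s0 := lt_le_trans r0 rs.
exists ((r / s) *: x); last by rewrite scalerA mulrC divfK// gt_eqF.
by apply: body_star; rewrite ?divr_gt0// ler_pdivrMr// mul1r.
Qed.

(** Openness of K: a point y of K can be stretched by some 1 + w > 1 inside K, so r y already lies
    in the dilate by r/(1 + w). *)
Lemma dilate_body_lt r x : 0 < r -> dilate r K x ->
  exists2 s, 0 < s < r & dilate s K x.
Proof.
move=> r0 [y Ky <-].
have /nbhs_ballP[e /= e0 eK] := open_nbhs_nbhs (conj openK Ky).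
have [M M0 yM] : exists2 M : R, 0 < M & forall i, `|y ord0 i| < M.
  exists (1 + \sum_i `|y ord0 i|); first by rewrite ltr_wpDr// sumr_ge0.
  by move=> i; rewrite (bigD1 i)//= addrCA ltrDl ltr_wpDr// sumr_ge0.
pose w := e / M; have w0 : 0 < w by rewrite divr_gt0.
have Ky' : K ((1 + w) *: y).
  apply: eK; split => // i j; rewrite (ord1 i) !mxE /ball /=.
  have -> : y ord0 j - (1 + w) * y ord0 j = - (w * y ord0 j) by ring.
  rewrite normrN normrM (gtr0_norm w0) /w mulrAC -mulrA.
  by rewrite gtr_pMr// mulrC ltr_pdivrMl// mulr1.
have w10 : 0 < 1 + w by rewrite addr_gt0.
exists (r / (1 + w)).
  by rewrite divr_gt0//= ltr_pdivrMr// ltr_pMr// ltrDl.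
by exists ((1 + w) *: y) => //; rewrite scalerA divfK// gt_eqF.
Qed.

Lemma open_dilate_body r : 0 < r -> open (dilate r K).
Proof.
move=> r0; rewrite (_ : dilate r K = (fun x => r^-1 *: x) @^-1` K).
  by apply: open_comp => // x _; exact: continuous_scale_rV.
by apply/seteqP; split => x /= /(dilateE K x (lt0r_neq0 r0)).
Qed.

Lemma volume_dilate_body r : 0 < r -> mu (dilate r K) = (r ^+ n.+1 * k)%:E.
Proof. by move=> r0; rewrite lebesgue_outer_dilate// body_volume_fin. Qed.

Definition body_radius a : R := (a / k) `^ n.+1%:R^-1.

Lemma body_radiusK a : 0 <= a -> body_radius a ^+ n.+1 * k = a.
Proof.
have k0 := body_volume_gt0 => a0.
by rewrite powR_rootK ?divfK ?gt_eqF// divr_ge0// ltW.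
Qed.

Lemma body_radius_gt0 a : 0 < a -> 0 < body_radius a.
Proof. by move=> a0; rewrite powR_gt0// divr_gt0// body_volume_gt0. Qed.

Lemma le_body_radius r a : 0 <= r -> 0 <= a ->
  (r <= body_radius a) = (r ^+ n.+1 * k <= a).
Proof.
move=> r0 a0; have k0 := body_volume_gt0.
by rewrite -[in RHS](body_radiusK a0) ler_pM2r// ler_pXn2r ?nnegrE ?powR_ge0.
Qed.

(** One description for null, finite and infinite measure: the union of the dilates of volume
    strictly below that of A. Strictness costs nothing by [dilate_body_lt]. *)
Lemma set_rearrangementP A x : set_rearrangement K A x <->
  exists r, [/\ 0 < r, ((r ^+ n.+1 * k)%:E < mu A)%E & dilate r K x].
Proof.
have k0 := body_volume_gt0.
rewrite /set_rearrangement /lebesgue_rV -/k.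
have [A0|A0] := eqVneq (mu A) 0%E.
  split => // -[r [r0]]; rewrite A0 lte_fin ltNge mulr_ge0 ?exprn_ge0 ?(ltW r0)//.
  exact: ltW.
have [Ay|Ay] := eqVneq (mu A) +oo%E.
  rewrite Ay; split => [[r r0 rKx]|[r [r0 _ rKx]]]; last by exists r.
  by exists r; split => //; rewrite ltry.
have Af : mu A \is a fin_num by rewrite ge0_fin_numE ?lebesgue_outer_ge0// ltey.
have mA0 : 0 < fine (mu A) by rewrite fine_gt0// lt0e A0 lebesgue_outer_ge0 ltey.
rewrite -/(body_radius (fine (mu A))).
have q0 := body_radius_gt0 mA0.
split => [/(dilate_body_lt q0)[r /andP[r0 rq] rK]|[r [r0 rA rK]]].
  exists r; split => //; rewrite -(fineK Af) lte_fin -(body_radiusK (ltW mA0)).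
  by rewrite ltr_pM2r// ltr_pXn2r// ?nnegrE ltW.
apply: (dilate_body_homo r0) rK; rewrite le_body_radius ?(ltW r0) ?(ltW mA0)//.
by rewrite -lee_fin (fineK Af) ltW.
Qed.

Lemma dilate_sub_rearrangement A r : 0 < r -> ((r ^+ n.+1 * k)%:E <= mu A)%E ->
  dilate r K `<=` set_rearrangement K A.
Proof.
move=> r0 rA x /(dilate_body_lt r0)[s /andP[s0 sr] sK].
apply/set_rearrangementP; exists s; split => //; apply: lt_le_trans rA.
by rewrite lte_fin ltr_pM2r ?body_volume_gt0// ltr_pXn2r// ?nnegrE ltW.
Qed.

Lemma le_set_rearrangement A B : A `<=` B ->
  set_rearrangement K A `<=` set_rearrangement K B.
Proof.
move=> AB x /set_rearrangementP[r [r0 rA rK]]; apply/set_rearrangementP.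
by exists r; split => //; apply: lt_le_trans rA _; exact: le_lebesgue_outer.
Qed.

Lemma open_set_rearrangement A : open (set_rearrangement K A).
Proof.
rewrite openE => x /set_rearrangementP[r [r0 rA rK]].
have := open_nbhs_nbhs (conj (open_dilate_body r0) rK).
by apply: filterS; apply: dilate_sub_rearrangement => //; exact: ltW.
Qed.

Lemma fun_rearrangement_ge0 f x : (0 <= fun_rearrangement K f x)%E.
Proof. by apply: integral_ge0 => s _; rewrite lee_fin. Qed.

(** Rearranged superlevel sets decrease with the level, so if x misses the one at u, the integrand
    defining the rearrangement vanishes beyond u and its integral is at most u. *)
Lemma lt_fun_rearrangement f x u : 0 <= u -> (u%:E < fun_rearrangement K f x)%E ->
  set_rearrangement K [set y | u < f y] x.
Proof.
move=> u0 uf; apply: contrapT => nx; move: uf; rewrite ltNge => /negP; apply.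
rewrite /fun_rearrangement.
apply: (@le_trans _ _ (\int[lebesgue_measure]_(s in `[0%R, +oo[)
    (\1_(`[0, u]%classic : set R) s)%:E)%E).
  apply: ge0_le_integral_lower => [s _|s]; first by rewrite lee_fin.
  rewrite /= in_itv/= andbT => s0; rewrite lee_fin.
  have [su|us] := leP s u.
    rewrite [leRHS]indicE mem_set ?indicE ?ler_nat ?leq_b1//=.
    by rewrite in_itv/= s0.
  suff -> : \1_(set_rearrangement K [set y | s < f y]) x = 0 :> R by [].
  rewrite indicE; apply/eqP; rewrite pnatr_eq0 eqb0; apply/negP => /set_mem h.
  apply: nx; move: h; apply: le_set_rearrangement => y /=; exact: lt_trans.
rewrite integral_indic//.
apply: (@le_trans _ _ (lebesgue_measure (`[0, u]%classic : set R))).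
  by rewrite le_measure ?inE//; apply: measurableI.
rewrite lebesgue_measure_itv/= lte_fin; case: ifP => _.
  by rewrite -EFinB subr0.
by rewrite lee_fin.
Qed.

Lemma ge_fun_rearrangement f x u : 0 <= u ->
  (forall s, 0 <= s < u -> set_rearrangement K [set y | s < f y] x) ->
  (u%:E <= fun_rearrangement K f x)%E.
Proof.
move=> u0 h; rewrite /fun_rearrangement.
apply: (@le_trans _ _ (\int[lebesgue_measure]_(s in `[0%R, +oo[)
    (\1_(`[0, u[%classic : set R) s)%:E)%E).
  rewrite integral_indic//.
  apply: (@le_trans _ _ (lebesgue_measure (`[0, u[%classic : set R))).
    rewrite lebesgue_measure_itv/= lte_fin.
    by case: ltP => [_|u0']; rewrite -?EFinB ?subr0 ?lee_fin.
  rewrite le_measure ?inE//; first by apply: measurableI.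
  move=> s su; split => //.
  by move: su; rewrite /= !in_itv/= andbT => /andP[].
apply: ge0_le_integral_lower => [s _|s _]; first by rewrite lee_fin.
rewrite lee_fin !indicE; case: (boolP (s \in `[0, u[%classic)) => //.
rewrite inE /= in_itv/= => su; rewrite mem_set//; exact: h.
Qed.

End rearrangement_lemmas.

(** * Sup-convolutions *)

Section sup_convolution_lemmas.
Context (R : realType) (n : nat) (lam : R) (p : \bar R).
Hypothesis ll : 0 < lam < 1.
Local Notation V := 'rV[R]_n.+1.
Local Notation mu := (@lebesgue_outer R n).
Local Notation VC := (caratheodory_type mu).
Implicit Types (F G : V -> \bar R) (f g : V ->
  R) (x y z : V) (r s t u v : R) (K : set V).
Local Notation conv F G := (sup_convolution lam (epmean lam p) F G).

Lemma convex_combE z : (1 - lam) *: z + lam *: z = z.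
Proof. by rewrite -scalerDl subrK scale1r. Qed.

Lemma sup_convolution_ge0 F G z :
  (forall x, 0 <= F x)%E -> (forall x, 0 <= G x)%E -> (0 <= conv F G z)%E.
Proof.
move=> F0 G0; apply: (le_trans (epmean_ge0 lam p (F0 z) (G0 z))).
by apply: ereal_sup_ubound; exists (z, z) => //=; rewrite convex_combE.
Qed.

Lemma lt_sup_convolution F G s z : (forall x, 0 <= F x)%E -> (forall x, 0 <= G x)%E ->
  0 <= s -> (s%:E < conv F G z)%E ->
  exists x y u v, [/\ (1 - lam) *: x + lam *: y = z, 0 < u /\ 0 < v,
    (u%:E < F x)%E, (v%:E < G y)%E & s < pmean lam p u v].
Proof.
move=> F0 G0 s0 /ereal_sup_gt[_ [[x y] /= xyz <-]] sM.
have [u [v [u0 v0 uF vG suv]]] := lt_epmeanP ll s0 (F0 x) (G0 y) sM.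
by exists x, y, u, v.
Qed.

Lemma le_sup_convolution F G x y u v : 0 <= u -> 0 <= v ->
  (u%:E <= F x)%E -> (v%:E <= G y)%E ->
  ((pmean lam p u v)%:E <= conv F G ((1 - lam) *: x + lam *: y))%E.
Proof.
move=> u0 v0 uF vG; apply: (le_trans (pmean_le_epmean ll p u0 v0 uF vG)).
by apply: ereal_sup_ubound; exists (x, y).
Qed.

Lemma measurable_superlevel_ereal (h : V -> \bar R) :
  (forall s, measurable ([set x | (s%:E < h x)%E] : set VC)) ->
  measurable_fun [set: VC] h.
Proof.
move=> mh; apply: (measurability _ (ErealGenOInfty.measurableE R)).
move=> _ [_ [s ->] <-]; rewrite setTI (_ : _ @^-1` _ = [set x | (s%:E < h x)%E])//.
by apply/seteqP; split => x /=; rewrite in_itv/= andbT.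
Qed.

(** Superlevel sets at nonnegative levels are open: a small move of z is absorbed by x alone, with y
    fixed, since x ranges over the open rearrangement of a superlevel set of f. *)
Lemma measurable_sup_convolution_rearrangement K f g : rearrangement_body K ->
  measurable_fun [set: VC] (conv (fun_rearrangement K f) (fun_rearrangement K g)).
Proof.
move=> bK; apply: measurable_superlevel_ereal => s.
have F0 := fun_rearrangement_ge0 K f; have G0 := fun_rearrangement_ge0 K g.
have [s0|s0] := ltP s 0.
  rewrite (_ : [set _ | _] = setT); first exact: measurableT.
  apply/seteqP; split => // z _ /=; apply: lt_le_trans (sup_convolution_ge0 z F0 G0).
  by rewrite lte_fin.
apply: open_measurable_rV; rewrite openE => z /= sz.
have [x [y [u [v [<- [u0 v0] uF vG suv]]]]] := lt_sup_convolution F0 G0 s0 sz.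
have xA := lt_fun_rearrangement bK (ltW u0) uF.
have := open_nbhs_nbhs (conj (@open_set_rearrangement R n K bK [set y | u < f y]) xA).
move=> /nbhs_ballP[e /= e0 eA]; apply/nbhs_ballP.
have /andP[l0 l1] := ll; have l1' : 0 < 1 - lam by rewrite subr_gt0.
exists ((1 - lam) * e); first by rewrite /= mulr_gt0.
move=> w [_ hw] /=; pose x' := x + (1 - lam)^-1 *: (w - ((1 - lam) *: x + lam *: y)).
have -> : w = (1 - lam) *: x' + lam *: y.
  by apply/rowP => j; rewrite !mxE; field; rewrite gt_eqF.
suff x'A : set_rearrangement K [set y | u < f y] x'.
  apply: (@lt_le_trans _ _ (pmean lam p u v)%:E); first by rewrite lte_fin.
  apply: le_sup_convolution; rewrite ?(ltW u0) ?(ltW v0) ?(ltW vG)//.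
  apply: ge_fun_rearrangement; first exact: ltW.
  move=> t /andP[t0 tu]; move: x'A; apply: (le_set_rearrangement bK) => q /=.
  exact: lt_trans.
apply: eA; split => // i j; have := hw i j; rewrite (ord1 i) /ball /= !mxE.
move: (x ord0 j) (y ord0 j) (w ord0 j) => a b c h.
have -> : a - (a + (1 - lam)^-1 * (c - ((1 - lam) * a + lam * b))) =
   (1 - lam)^-1 * ((1 - lam) * a + lam * b - c) by ring.
by rewrite normrM gtr0_norm ?invr_gt0// ltr_pdivrMl.
Qed.

(** The sets S for different t need not be nested, so they are merged by a union; restricting t to
    rationals keeps that union countable, hence measurable. *)
Lemma measurable_kernel (A : set V) (Th : \bar R) :
  (forall t : rat, (0 <= ratr t :> R) -> ((ratr t : R)%:E < Th)%E ->
    exists S, [/\ measurable (S : set VC), S `<=` A & ((ratr t : R)%:E <= mu S)%E]) ->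
  exists L, [/\ measurable (L : set VC), L `<=` A & (Th <= mu L)%E].
Proof.
move=> h; have {}h (t : rat) : exists S, [/\ measurable (S : set VC), S `<=` A &
    ((ratr t : R)%:E < Th)%E -> ((ratr t : R)%:E <= mu S)%E].
  have [tT|tT] := boolP ((ratr t : R)%:E < Th)%E; last first.
    by exists set0; split => //; exact: measurable0.
  have [t0|t0] := leP 0 (ratr t : R).
    by have [S [mS SA tS]] := h t t0 tT; exists S.
  exists set0; split => // _.
  by rewrite lebesgue_outer0 lee_fin ltW.
have [S hS] := choice h; exists (\bigcup_t S t); split.
- by apply: countable_bigcupT_measurable => [|t]; [exact: countableP|case: (hS t)].
- by move=> x [t _]; case: (hS t) => _ + _; apply.
rewrite leNgt; apply/negP => lt.
have Lf : mu (\bigcup_t S t) \is a fin_num.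
  by rewrite ge0_fin_numE ?lebesgue_outer_ge0// (lt_le_trans lt)// leey.
set w := fine (mu (\bigcup_t S t)).
have [w' ww' w'T] : exists2 w', w < w' & (w'%:E <= Th)%E.
  move: lt; rewrite -(fineK Lf) -/w; case: Th {hS h} => [r| |]//.
    by rewrite lte_fin => ?; exists r.
  by move=> _; exists (w + 1); rewrite ?ltrDl// leey.
have /rat_in_itvoo[t] := ww'; rewrite in_itv/= => /andP[wt tw'].
have [_ _ /(_ _)] := hS t => /(_ (lt_le_trans _ w'T)); rewrite lte_fin => /(_ tw') tS.
have : ((ratr t : R)%:E <= mu (\bigcup_t S t))%E.
  by apply: le_trans tS _; apply: le_lebesgue_outer; exact: bigcup_sup.
by rewrite -(fineK Lf) lee_fin leNgt wt.
Qed.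

Lemma root_mean_body K r s : rearrangement_body K -> 0 < r -> 0 < s ->
  root_mean n lam (r ^+ n.+1 * fine (mu K)) (s ^+ n.+1 * fine (mu K)) =
  ((1 - lam) * r + lam * s) ^+ n.+1 * fine (mu K).
Proof.
move=> bK r0 s0; have k0 := body_volume_gt0 bK.
rewrite /root_mean !powRM ?exprn_ge0 ?(ltW r0) ?(ltW s0) ?(ltW k0)//.
rewrite !exprK_powR ?(ltW r0) ?(ltW s0)// !mulrA -mulrDl exprMn powR_rootK//.
exact: ltW.
Qed.

(** For a > 0, the dilate of K of volume a. The union form gives the empty set at a = 0, where
    dilation by 0 would give the origin. *)
Definition body_ball K (a : R) : set V :=
  [set z | exists r, [/\ 0 < r, r ^+ n.+1 * fine (mu K) <= a & dilate r K z]].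

Lemma body_ballE K a : rearrangement_body K -> 0 < a ->
  body_ball K a = dilate (body_radius K a) K.
Proof.
move=> bK a0; have q0 := body_radius_gt0 bK a0.
apply/seteqP; split => [z [r [r0 ra rz]]|z az].
  apply: (dilate_body_homo bK r0) rz.
  by rewrite le_body_radius// ltW.
by exists (body_radius K a); split => //; rewrite body_radiusK// ltW.
Qed.

Lemma body_ball0 K a : rearrangement_body K -> a <= 0 -> body_ball K a = set0.
Proof.
move=> bK a0; apply/seteqP; split => // z [r [r0 ra _]].
move: ra; rewrite leNgt => /negP; apply; apply: (le_lt_trans a0).
by rewrite mulr_gt0 ?exprn_gt0// body_volume_gt0.
Qed.

Lemma volume_body_ball K a : rearrangement_body K -> 0 <= a ->
  mu (body_ball K a) = a%:E.
Proof.
move=> bK; rewrite le_eqVlt => /predU1P[<-|a0].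
  by rewrite body_ball0// lebesgue_outer0.
rewrite body_ballE// volume_dilate_body ?body_radius_gt0// body_radiusK//.
exact: ltW.
Qed.

Lemma measurable_body_ball K a : rearrangement_body K ->
  measurable (body_ball K a : set VC).
Proof.
move=> bK; have [a0|a0] := leP a 0; first by rewrite body_ball0//; exact: measurable0.
by apply: open_measurable_rV; rewrite body_ballE//; apply: open_dilate_body => //;
  exact: body_radius_gt0.
Qed.

(* The superlevel sets on the rearranged side are unions of dilates of [K],
   hence nested, so that the measure of a union is a supremum of measures. *)
Lemma superlevel_rearrangement K f g s : rearrangement_body K ->
  measurable_fun [set: borel_rV R n] f -> measurable_fun [set: borel_rV R n] g ->
  (forall x, 0 <= f x) -> (forall x, 0 <= g x) -> 0 <= s ->
  exists L, [/\ measurable (L : set VC),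
    L `<=` [set z | (s%:E < conv (EFin \o f) (EFin \o g) z)%E] &
    (mu [set z | (s%:E < conv (fun_rearrangement K f) (fun_rearrangement K g) z)%E]
      <= mu L)%E].
Proof.
move=> bK mf mg f0 g0 s0; have k0 := body_volume_gt0 bK.
set k := fine (mu K) in k0; have /andP[l0 l1] := ll.
have l1' : 0 < 1 - lam by rewrite subr_gt0.
pose P a := exists u v r t, [/\ [/\ 0 < u, 0 < v & s < pmean lam p u v],
  0 < r /\ 0 < t, ((r ^+ n.+1 * k)%R%:E < mu [set x | (u < f x)%R])%E,
  ((t ^+ n.+1 * k)%R%:E < mu [set x | (v < g x)%R])%E &
  a = ((1 - lam) * r + lam * t) ^+ n.+1 * k].
(* [Th] separates the two sides: Brunn-Minkowski puts measurable sets of measure arbitrarily close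
   to [Th] in the original superlevel set, while the rearranged one lies in a dilate of K of volume
   [Th] if that is finite. The element 0 covers an empty [P]. *)
pose Th := ereal_sup [set a%:E | a in [set 0] `|` P].
have Th0 : (0 <= Th)%E by apply: ereal_sup_ubound; exists 0 => //; left.
suff hTh : (mu [set z | (s%:E < conv (fun_rearrangement K f)
  (fun_rearrangement K g) z)%E]
    <= Th)%E.
  have [q q0 qTh|L [mL LA ThL]] := @measurable_kernel
      [set z | (s%:E < conv (EFin \o f) (EFin \o g) z)%E] Th; last first.
    by exists L; split => //; exact: le_trans hTh ThL.
  have [_ [a [->|Pa] <-]] := ereal_sup_gt qTh.
    by rewrite lte_fin ltNge q0.
  rewrite lte_fin => qa.
  have [u [v [r [t [[u0 v0 suv] [r0 t0] rf tg aE]]]]] := Pa.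
  have rk0 : 0 < r ^+ n.+1 * k by rewrite mulr_gt0 ?exprn_gt0.
  have tk0 : 0 < t ^+ n.+1 * k by rewrite mulr_gt0 ?exprn_gt0.
  have [S [mS SAB aS]] := brunn_minkowski ll (measurable_fun_superlevel u mf)
    (measurable_fun_superlevel v mg) rk0 tk0 rf tg.
  exists S; split => //; last first.
    apply: le_trans aS; rewrite root_mean_body// lee_fin -aE.
    exact: ltW.
  move=> z /SAB[x [y [/= uf vg ->]]].
  apply: (@lt_le_trans _ _ (pmean lam p (f x) (g y))%:E).
    by rewrite lte_fin (lt_le_trans suv)// le_pmean// ltW.
  exact: le_sup_convolution.
have sub a : (0 <= a)%R -> (Th <= a%:E)%E ->
  [set z | (s%:E < conv (fun_rearrangement K f) (fun_rearrangement K g) z)%E]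
    `<=` body_ball K a.
  move=> a0 Tha z /= sz.
  have [x [y [u [v [<- [u0 v0] uF vG suv]]]]] := lt_sup_convolution
    (fun_rearrangement_ge0 K f) (fun_rearrangement_ge0 K g) s0 sz.
  have /(set_rearrangementP bK)[r [r0 rf [x' Kx' <-]]] :=
    lt_fun_rearrangement bK (ltW u0) uF.
  have /(set_rearrangementP bK)[t [t0 tg [y' Ky' <-]]] :=
    lt_fun_rearrangement bK (ltW v0) vG.
  exists ((1 - lam) * r + lam * t); split.
  - by rewrite addr_gt0 ?mulr_gt0.
  - rewrite -lee_fin; apply: le_trans Tha; apply: ereal_sup_ubound.
    exists (((1 - lam) * r + lam * t) ^+ n.+1 * k) => //; right.
    by exists u, v, r, t.
  - by rewrite !scalerA; apply: body_dilate_sum => //; rewrite mulr_gt0.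
have [Thy|Thy] := eqVneq Th +oo%E; first by rewrite Thy leey.
have Thf : Th \is a fin_num by rewrite ge0_fin_numE// ltey.
apply: (@le_trans _ _ (mu (body_ball K (fine Th)))).
  by apply: le_lebesgue_outer; apply: sub; rewrite ?fine_ge0// fineK.
by rewrite volume_body_ball ?fine_ge0// fineK.
Qed.

Lemma integral_rearrangement_le K f g : rearrangement_body K ->
  measurable_fun [set: borel_rV R n] f -> measurable_fun [set: borel_rV R n] g ->
  (forall x, 0 <= f x) -> (forall x, 0 <= g x) ->
  (\int[lebesgue_rV]_x conv (fun_rearrangement K f) (fun_rearrangement K g) x <=
   \int[lebesgue_rV]_x conv (EFin \o f) (EFin \o g) x)%E.
Proof.
move=> bK mf mg f0 g0.
set h' := conv (fun_rearrangement K f) (fun_rearrangement K g).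
set h := conv (EFin \o f) (EFin \o g).
have h'0 x : (0 <= h' x)%E.
  by apply: sup_convolution_ge0 => y; exact: fun_rearrangement_ge0.
have h0 x : (0 <= h x)%E by apply: sup_convolution_ge0 => y; rewrite lee_fin.
have I0 : (0 <= \int[lebesgue_rV]_x h x)%E by apply: integral_ge0.
rewrite leNgt; apply/negP => lt.
have If : (\int[lebesgue_rV]_x h x)%E \is a fin_num.
  by rewrite ge0_fin_numE// (lt_le_trans lt)// leey.
move: lt; rewrite -(fineK If) => lt.
have mh' := measurable_sup_convolution_rearrangement f g bK.
have [dl [J [dl0]]] := lt_integral_layer_sum mh' h'0 (fine_ge0 I0) lt.
rewrite fineK// ltNge => /negP; apply.
have hL j : exists L, [/\ measurable (L : set VC),
    L `<=` [set z | ((dl * j.+1%:R)%:E < h z)%E] &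
    (mu [set z | ((dl * j.+1%:R)%:E < h' z)%E] <= mu L)%E].
  by apply: superlevel_rearrangement => //; rewrite mulr_ge0// ltW.
have [L hL'] := choice hL.
apply: le_trans (@layer_sum_le_integral R _ VC (@lebesgue_rV R n) h L dl J _ h0 _ _).
- by apply: lee_sum => j _; rewrite lee_wpmul2l ?lee_fin ?(ltW dl0)//; case: (hL' j).
- exact: ltW.
- by move=> j; case: (hL' j).
- by move=> j x; case: (hL' j) => _ + _; apply.
Qed.

End sup_convolution_lemmas.

(** * Matching step functions *)

Section profiles.
Context (R : realType).
Implicit Types (F : R -> R -> Prop) (s : seq (R * R)) (x y a m dl u v : R).

(* A list of pairs (value, mass) describes a step function; [F a x] says that
   the value [a] is attained up to the position [x]. *)
Fixpoint profile F x s : Prop :=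
  match s with
  | [::] => True
  | q :: s' => [/\ 0 < q.1, 0 <= q.2, F q.1 (x + q.2) & profile F (x + q.2) s']
  end.

Definition profile_sum s : R := \sum_(q <- s) q.1 * q.2.

Lemma profile_sum_cons q s : profile_sum (q :: s) = q.1 * q.2 + profile_sum s.
Proof. by rewrite /profile_sum big_cons. Qed.

(** With X i the measure above level dl (i+1), the pieces run from the highest level down, each
    extending the position already reached to the next X; [profile_sum_layer] is the resulting
    summation by parts. *)
Fixpoint layer_profile dl (X : nat -> R) (j : nat) x : seq (R * R) :=
  match j with
  | 0%N => [::]
  | j'.+1 => (dl * j'.+1%:R, X j' - x) :: layer_profile dl X j' (X j')
  end.

Lemma profile_sum_layer dl X j x :
  profile_sum (layer_profile dl X j x) = dl * \sum_(i < j) X i - dl * j%:R * x.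
Proof.
elim: j x => [|j ih] x; first by rewrite /profile_sum !big_nil big_ord0; ring.
by rewrite /= profile_sum_cons ih big_ord_recr/= -natr1; ring.
Qed.

Lemma profile_layer F dl X j x : 0 < dl ->
  (forall i, (i < j)%N -> F (dl * i.+1%:R) (X i)) ->
  (forall i, (i.+1 < j)%N -> X i.+1 <= X i) ->
  (forall i, (i < j)%N -> j = i.+1 -> x <= X i) ->
  profile F x (layer_profile dl X j x).
Proof.
move=> dl0; elim: j x => [|j ih] x hF hX hx //=.
have e : x + (X j - x) = X j by rewrite addrC subrK.
split; rewrite ?e//.
- by rewrite mulr_gt0.
- by rewrite subr_ge0 hx.
- exact: hF.
- apply: ih => [i ij|i ij|i ij ji].
  + by apply: hF; rewrite (ltn_trans ij).
  + by apply: hX; rewrite (ltn_trans ij).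
  + by rewrite ji; apply: hX; rewrite -ji.
Qed.

Context (n : nat) (lam : R) (p : \bar R).
Hypothesis ll : 0 < lam < 1.
Hypothesis hp : ((- (n.+1%:R^-1))%:E <= p)%E.
(** In the application F and G are [level_reaches] of f and g, S and T their profile sums, Phi m the
    integral of the rearranged sup-convolution over [body_ball K m], and I its full integral. *)
Variables (F G : R -> R -> Prop) (S T : R) (Phi : R -> \bar R) (I : \bar R).
Hypothesis S0 : 0 < S.
Hypothesis T0 : 0 < T.
Hypothesis F_down : forall a x y, 0 <= x -> x <= y -> F a y -> F a x.
Hypothesis G_down : forall a x y, 0 <= x -> x <= y -> G a y -> G a x.
Hypothesis PhiI : forall a, (Phi a <= I)%E.
Hypothesis Phi_step : forall a b x y m, 0 < a -> 0 < b -> 0 < x -> 0 < y ->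
  F a x -> G b y -> 0 <= m -> m <= root_mean n lam x y ->
  (Phi m + (pmean lam p a b * (root_mean n lam x y - m))%:E <=
   Phi (root_mean n lam x y))%E.
Let c := pmean lam (mean_exponent n.+1 p) S T.

Let c0 : 0 <= c. Proof. by rewrite pmean_ge0 ?ltW. Qed.

(** By Hoelder, t c is at most the mean of a and b times the root mean of the increments m, m', and
    by superadditivity that root mean is at most the growth of the combined volume. *)
Lemma profile_advance a b x y m m' t : 0 <= x -> 0 <= y -> 0 < a -> 0 < b ->
  0 < m -> 0 < m' -> F a (x + m) -> G b (y + m') -> a * m = t * S -> b * m' = t * T ->
  (Phi (root_mean n lam x y) + (t * c)%:E <= Phi (root_mean n lam (x + m) (y + m')))%E.
Proof.
move=> x0 y0 a0 b0 m0 m'0 Fx Gy am bm'.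
have t0 : 0 < t by rewrite -(pmulr_lgt0 _ S0) -am mulr_gt0.
have sup := root_mean_superadditive n ll x0 y0 (ltW m0) (ltW m'0).
have hoe := root_mean_hoelder ll hp (ltW m0) (ltW m'0) a0 b0.
rewrite (mulrC m) (mulrC m') am bm' pmean_homo ?(ltW S0) ?(ltW T0)// -/c in hoe.
have pm0 : 0 < pmean lam p a b by rewrite pmean_gt0.
have rm0 := root_mean_ge0 n x y ll.
apply: le_trans (Phi_step a0 b0 _ _ Fx Gy rm0 _).
- rewrite leeD2l// lee_fin; apply: (le_trans hoe).
  by rewrite mulrC ler_wpM2l ?(ltW pm0)//; lra.
- by rewrite ltr_wpDl.
- by rewrite ltr_wpDl.
- apply: le_trans sup; rewrite lerDl; exact: root_mean_ge0.
Qed.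

(* Both step functions are traversed simultaneously, advancing at each step by
   the same fraction [t] of the integrals [S] and [T]. *)
Lemma profile_match s s' x y t : 0 <= x -> 0 <= y -> profile F x s -> profile G y s' ->
  profile_sum s = t * S -> profile_sum s' = t * T ->
  (Phi (root_mean n lam x y) + (t * c)%:E <= I)%E.
Proof.
have [N] := ubnP (size s + size s')%N.
elim: N s s' x y t => // N ih s s' x y t; rewrite ltnS => sN x0 y0 ps ps' sS sT.
have t0I : t = 0 -> (Phi (root_mean n lam x y) + (t * c)%:E <= I)%E.
  by move=> ->; rewrite mul0r adde0.
case: s sN ps sS => [|[a m] s] sN ps sS.
  apply: t0I; move: sS; rewrite /profile_sum big_nil => /esym/eqP.
  by rewrite mulf_eq0 (gt_eqF S0) orbF => /eqP.
case: s' sN ps' sT => [|[b m'] s'] sN ps' sT.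
  apply: t0I; move: sT; rewrite /profile_sum big_nil => /esym/eqP.
  by rewrite mulf_eq0 (gt_eqF T0) orbF => /eqP.
rewrite /= addnS addSn in sN.
rewrite profile_sum_cons /= in sS; rewrite profile_sum_cons /= in sT.
have [/= a0 m0 Fa pss] := ps; have [/= b0 m'0 Gb pss'] := ps'.
have [mE|mN] := eqVneq m 0.
  rewrite mE addr0 in pss; rewrite mE mulr0 add0r in sS.
  by apply: (ih s ((b, m') :: s')) => //=; rewrite ?profile_sum_cons// addnS.
have [m'E|m'N] := eqVneq m' 0.
  rewrite m'E addr0 in pss'; rewrite m'E mulr0 add0r in sT.
  by apply: (ih ((a, m) :: s) s') => //=; rewrite profile_sum_cons.
have {mN}m_gt0 : 0 < m by rewrite lt_def mN.
have {m'N}m'_gt0 : 0 < m' by rewrite lt_def m'N.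
(* The leading piece carrying the smaller fraction of its integral is consumed whole, the other one
   only up to the same fraction w. One list thus loses an element, so the total size decreases. *)
have [AB|BA] := leP (a * m / S) (b * m' / T).
  pose w := a * m / S; pose m1 := w * T / b.
  have w0 : 0 < w by rewrite divr_gt0 ?mulr_gt0.
  have m1_gt0 : 0 < m1 by rewrite divr_gt0// (mulr_gt0 w0).
  have m1m' : m1 <= m'.
    by rewrite /m1 ler_pdivrMr// (mulrC m') -ler_pdivlMr.
  have am : a * m = w * S by rewrite /w divfK// gt_eqF.
  have bm1 : b * m1 = w * T by rewrite /m1 mulrC divfK// gt_eqF.
  have Gb1 : G b (y + m1) by apply: G_down Gb; rewrite ?lerD2l// addr_ge0// ltW.
  have := profile_advance x0 y0 a0 b0 m_gt0 m1_gt0 Fa Gb1 am bm1.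
  have e : y + m1 + (m' - m1) = y + m' by rewrite -addrA subrKC.
  have := @ih s ((b, m' - m1) :: s') (x + m) (y + m1) (t - w).
  rewrite /= addnS sN => /(_ isT (addr_ge0 x0 m0) (addr_ge0 y0 (ltW m1_gt0)) pss).
  rewrite e subr_ge0 profile_sum_cons /= => /(_ (And4 b0 m1m' Gb pss')) h1 h2.
  apply: le_trans (h1 _ _); last 2 first.
  - by rewrite mulrBl -am -sS addrC addKr.
  - by rewrite mulrBr bm1 mulrBl -sT; ring.
  rewrite [X in (_ + X)%E](_ : _ = (w * c)%:E + ((t - w) * c)%:E)%E; last first.
    by rewrite -EFinD; congr (_%:E); ring.
  by rewrite addeA leeD2r.
pose w := b * m' / T; pose m1 := w * S / a.
have w0 : 0 < w by rewrite divr_gt0 ?mulr_gt0.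
have m1_gt0 : 0 < m1 by rewrite divr_gt0// (mulr_gt0 w0).
have m1m : m1 <= m.
  by rewrite /m1 ler_pdivrMr// (mulrC m) -ler_pdivlMr// ltW.
have bm' : b * m' = w * T by rewrite /w divfK// gt_eqF.
have am1 : a * m1 = w * S by rewrite /m1 mulrC divfK// gt_eqF.
have Fa1 : F a (x + m1) by apply: F_down Fa; rewrite ?lerD2l// addr_ge0// ltW.
have := profile_advance x0 y0 a0 b0 m1_gt0 m'_gt0 Fa1 Gb am1 bm'.
have e : x + m1 + (m - m1) = x + m by rewrite -addrA subrKC.
have := @ih ((a, m - m1) :: s) s' (x + m1) (y + m') (t - w).
rewrite /= addSn sN => /(_ isT (addr_ge0 x0 (ltW m1_gt0)) (addr_ge0 y0 m'0)).
rewrite e subr_ge0 profile_sum_cons /= => /(_ (And4 a0 m1m Fa pss) pss') h1 h2.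
apply: le_trans (h1 _ _); last 2 first.
- by rewrite mulrBr am1 mulrBl -sS; ring.
- by rewrite mulrBl -bm' -sT addrC addKr.
rewrite [X in (_ + X)%E](_ : _ = (w * c)%:E + ((t - w) * c)%:E)%E; last first.
  by rewrite -EFinD; congr (_%:E); ring.
by rewrite addeA leeD2r.
Qed.

End profiles.

(** * The lower bound by the mean of the integrals *)

Section integral_mean.
Context (R : realType) (n : nat).
Local Notation V := 'rV[R]_n.+1.
Local Notation mu := (@lebesgue_outer R n).
Local Notation VC := (caratheodory_type mu).
Implicit Types (f g : V -> R) (x y m a b u v : R) (K : set V).

(** Quantifying over all levels below a, not at a, matches [ge_fun_rearrangement]: it makes the
    rearrangement at least a on the dilate of volume x, for x > 0. *)
Definition level_reaches f a x : Prop :=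
  forall s, 0 <= s < a -> (x%:E <= mu [set z | (s < f z)%R])%E.

Lemma level_reaches_down f a x y : x <= y -> level_reaches f a y -> level_reaches f a x.
Proof. by move=> xy h s /h; apply: le_trans; rewrite lee_fin. Qed.

Lemma profile_exists f u : measurable_fun [set: borel_rV R n] f ->
  (forall z, 0 <= f z) -> 0 <= u -> (u%:E < \int[lebesgue_rV]_z (f z)%:E)%E ->
  exists s, profile (level_reaches f) 0 s /\ u < profile_sum s.
Proof.
move=> mf f0 u0 uf.
have [dl [J [dl0 usum]]] := lt_integral_layer_sum (measurable_fun_EFin_rV mf)
  (fun z => f0 z) u0 uf.
pose A (j : nat) : \bar R := mu [set z | (dl * j.+1%:R < f z)%R].
have {}usum : (u%:E < \sum_(j < J) dl%:E * A j)%E by [].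
have A0 j : (0 <= A j)%E by exact: lebesgue_outer_ge0.
have Areach j s : 0 <= s < dl * j.+1%:R -> (A j <= mu [set z | (s < f z)%R])%E.
  move=> /andP[_ sj]; apply: le_lebesgue_outer => z /=; exact: lt_trans.
have Amono i j : (i <= j)%N -> (A j <= A i)%E.
  move=> ij; apply: le_lebesgue_outer => z /=; apply: le_lt_trans.
  by rewrite ler_pM2l// ler_nat.
(* If the lowest superlevel set has infinite measure, a single piece of height dl and length (u +
   1)/dl already has mass u + 1. *)
have [A0y|A0y] := eqVneq (A 0%N) +oo%E.
  pose X (j : nat) := (u + 1) / dl.
  have u1 : 0 < u + 1 by rewrite ltr_wpDl.
  exists (layer_profile dl X 1 0); split.
    apply: profile_layer => // [[|//] _ s /Areach|i _ _].
      by rewrite A0y leye_eq => /eqP ->; rewrite leey.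
    by rewrite divr_ge0// ltW.
  rewrite profile_sum_layer mulr0 subr0 big_ord1 /X mulrC divfK ?gt_eqF//.
  by rewrite ltrDl.
have Af j : A j \is a fin_num.
  by rewrite ge0_fin_numE// (le_lt_trans (Amono _ _ (leq0n j)))// ltey.
pose X j := fine (A j).
exists (layer_profile dl X J 0); split.
  apply: profile_layer => // [i _ s /Areach|i _|i _ _].
  - by rewrite fineK.
  - by rewrite fine_le// Amono.
  - by rewrite fine_ge0.
rewrite profile_sum_layer mulr0 subr0 mulr_sumr -lte_fin -sumEFin.
by under eq_bigr do rewrite EFinM fineK//.
Qed.

Context (lam : R) (p : \bar R).
Hypothesis ll : 0 < lam < 1.
Hypothesis hp : ((- (n.+1%:R^-1))%:E <= p)%E.

(** The volume [root_mean n lam x y] is that of K dilated by (1 - lam) rx + lam ry, with rx and ry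
    the radii for x and y, so z is a combination of rx w and ry w for one w in K. *)
Lemma ge_sup_convolution_rearrangement K f g a b x y z : rearrangement_body K ->
  0 < a -> 0 < b -> 0 < x -> 0 < y -> level_reaches f a x -> level_reaches g b y ->
  body_ball K (root_mean n lam x y) z ->
  ((pmean lam p a b)%:E <= sup_convolution lam (epmean lam p)
     (fun_rearrangement K f) (fun_rearrangement K g) z)%E.
Proof.
move=> bK a0 b0 x0 y0 fx gy [r [r0 rxy rz]].
have rx0 := body_radius_gt0 bK x0; have ry0 := body_radius_gt0 bK y0.
have xE := body_radiusK bK (ltW x0); have yE := body_radiusK bK (ltW y0).
set rx := body_radius K x in rx0 xE; set ry := body_radius K y in ry0 yE.
have rr0 : 0 < (1 - lam) * rx + lam * ry by rewrite convex_comb_gt0.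
move: rxy; rewrite -{1}xE -{1}yE root_mean_body//.
rewrite ler_pM2r ?body_volume_gt0// ler_pXn2r// ?nnegrE ?(ltW r0) ?(ltW rr0)// => rle.
have [w Kw <-] := dilate_body_homo bK r0 rle rz.
rewrite scalerDl -!scalerA; apply: le_sup_convolution => //.
- exact: ltW.
- exact: ltW.
- apply: ge_fun_rearrangement; first exact: ltW.
  move=> s sa; apply: (dilate_sub_rearrangement bK rx0); last by exists w.
  by rewrite xE; exact: fx.
- apply: ge_fun_rearrangement; first exact: ltW.
  move=> s sa; apply: (dilate_sub_rearrangement bK ry0); last by exists w.
  by rewrite yE; exact: gy.
Qed.

Lemma integral_body_ball_step K (h : V -> \bar R) c m m' : rearrangement_body K ->
  measurable_fun [set: VC] h -> (forall z, 0 <= h z)%E ->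
  0 <= c -> 0 <= m -> m <= m' ->
  (forall z, body_ball K m' z -> (c%:E <= h z)%E) ->
  (\int[lebesgue_rV]_(z in body_ball K m) h z + (c * (m' - m))%:E <=
   \int[lebesgue_rV]_(z in body_ball K m') h z)%E.
Proof.
move=> bK mh h0 c0 m0 mm' hc.
have sub : body_ball K m `<=` body_ball K m'.
  by move=> z [r [r0 rm rz]]; exists r; split => //; exact: le_trans mm'.
have mB a : measurable (body_ball K a : set VC) by exact: measurable_body_ball.
have mD : measurable (body_ball K m' `\` body_ball K m : set VC) by exact: measurableD.
rewrite -[in leRHS](setDUK sub).
rewrite (@ge0_integral_setU _ VC R (@lebesgue_rV R n) _ _ (mB m) mD); first last.
- by rewrite disj_set2E setDIK.
- by move=> z _; exact: h0.
- exact: measurable_funTS.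
rewrite leeD2l//.
apply: (@le_trans _ _ (\int[lebesgue_rV]_(z in body_ball K m' `\` body_ball K m)
   cst c%:E z)%E); last first.
  apply: ge0_le_integral_lower => z; first by rewrite lee_fin.
  by move=> [zm' _]; exact: hc.
rewrite integral_cst// EFinM lee_wpmul2l ?lee_fin//.
have V' := volume_body_ball bK (le_trans m0 mm'); have V0 := volume_body_ball bK m0.
have V'y : (mu (body_ball K m') < +oo)%E by rewrite V' ltry.
have VD : mu (body_ball K m' `\` body_ball K m) =
    (mu (body_ball K m') - mu (body_ball K m' `&` body_ball K m))%E :=
  @measureD _ VC R (@lebesgue_rV R n) _ _ (mB m') (mB m) V'y.
rewrite (setIidr sub) V' V0 -EFinB in VD.
suff : ((m' - m)%:E <= mu (body_ball K m' `\` body_ball K m))%E by [].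
by rewrite VD.
Qed.

Lemma integral_rearrangement_ge K f g : rearrangement_body K ->
  measurable_fun [set: borel_rV R n] f -> measurable_fun [set: borel_rV R n] g ->
  (forall z, 0 <= f z) -> (forall z, 0 <= g z) ->
  (epmean lam (mean_exponent n.+1 p)
     (\int[lebesgue_rV]_z (f z)%:E) (\int[lebesgue_rV]_z (g z)%:E) <=
   \int[lebesgue_rV]_z sup_convolution lam (epmean lam p)
     (fun_rearrangement K f) (fun_rearrangement K g) z)%E.
Proof.
move=> bK mf mg f0 g0.
set h := sup_convolution _ _ _ _; set I := (X in (_ <= X)%E).
have h0 z : (0 <= h z)%E by apply: sup_convolution_ge0 => w;
  exact: fun_rearrangement_ge0.
have mh : measurable_fun [set: VC] h by exact: measurable_sup_convolution_rearrangement.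
apply: epmean_le => //.
- by apply: integral_ge0 => z _; rewrite lee_fin.
- by apply: integral_ge0 => z _; rewrite lee_fin.
- by apply: integral_ge0.
move=> u v u0 v0 uf vg.
have [s [ps us]] := profile_exists mf f0 (ltW u0) uf.
have [s' [ps' vs']] := profile_exists mg g0 (ltW v0) vg.
pose Phi a := (\int[lebesgue_rV]_(z in body_ball K a) h z)%E.
have S0 := lt_trans u0 us; have T0 := lt_trans v0 vs'.
have := @profile_match R n lam p ll hp (level_reaches f) (level_reaches g)
  (profile_sum s) (profile_sum s') Phi I S0 T0 _ _ _ _ s s' 0 0 1 (lexx 0)
    (lexx 0) ps ps'.
rewrite !mul1r => H.
apply: (@le_trans _ _ (pmean lam (mean_exponent n.+1 p) (profile_sum s)
  (profile_sum s'))%:E).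
  by rewrite lee_fin le_pmean// ltW.
apply: le_trans (H _ _ _ _ erefl erefl).
- by rewrite leeDr// integral_ge0.
- by move=> a x y _; exact: level_reaches_down.
- by move=> a x y _; exact: level_reaches_down.
- move=> a; apply: ge0_subset_integral => //; first exact: measurable_body_ball.
- move=> a b x y m a0 b0 x0 y0 fx gy m0 mxy; apply: integral_body_ball_step => //.
    by rewrite pmean_ge0// ltW.
  by move=> z; exact: ge_sup_convolution_rearrangement.
Qed.

End integral_mean.

Theorem theorem5p2 (R : realType) (n : nat) (lam : R) (p : \bar R)
    (K : set 'rV[R]_n.+1) (f g : 'rV[R]_n.+1 -> R) :
  0 < lam < 1 ->
  ((- (n.+1%:R^-1))%:E <= p)%E ->
  rearrangement_body K ->
  measurable_fun [set: borel_rV R n] f ->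
  measurable_fun [set: borel_rV R n] g ->
  (forall x, 0 <= f x) ->
  (forall x, 0 <= g x) ->
  (\int[lebesgue_rV]_x sup_convolution lam (epmean lam p)
                         (EFin \o f) (EFin \o g) x
     >= \int[lebesgue_rV]_x sup_convolution lam (epmean lam p)
                              (fun_rearrangement K f)
                              (fun_rearrangement K g) x)%E /\
  (\int[lebesgue_rV]_x sup_convolution lam (epmean lam p)
                         (fun_rearrangement K f) (fun_rearrangement K g) x
     >= epmean lam (mean_exponent n.+1 p)
          (\int[lebesgue_rV]_x (f x)%:E) (\int[lebesgue_rV]_x (g x)%:E))%E.
Proof.
move=> ll hp bK mf mg f0 g0; split.
  exact: integral_rearrangement_le.
exact: integral_rearrangement_ge.
Qed.
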